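(* Let $Mv_0+g(\varepsilon,v_0)>0$ and let $\tau_k\ge0$ be sufficiently small. Then the solution sequence $\{v_k\}_{k\ge0}$ of the scheme $$v_{k+1}=\Phi_kv_k+M^{-1}[\Phi_k-I]\,[\theta g(\varepsilon,v_k)+(1-\theta)g(\varepsilon,v_{k+1})],\qquad k\ge0,$$ is monotonically increasing while maintaining $0\le v_k<1$, $k\ge0$.
   Context: All vector inequalities are componentwise. $\theta\in[0,1]$ is a fixed parameter. The scheme is a time discretization of the semi-discretized system $v'(t)=Mv(t)+g(\varepsilon,v(t))$, $t_0<t<T_q$, $v(t_0)=v_0$, obtained by finite differences in space from the degenerate stochastic Kawarada problem $u_t=\frac{1}{a^2\sigma}u_{xx}+\frac{1}{b^2\sigma}u_{yy}+g(\varepsilon,u)$ on $\mathcal{D}=(-1,1)\times(-1,1)$, $t_0<t<T_q<\infty$, with $u=0$ on $\partial\mathcal{D}$ and $u(x,y,t_0)=u_0(x,y)\ll1$. $v_0$ is the initial vector, $v_k$ approximates $v(t_k)$, and $t_k=t_0+\sum_{j=0}^{k-1}\tau_j$ with adaptive temporal steps $\tau_k$. Mesh: $a,b>0$, $N_x,N_y\gg1$, $-1=x_0<x_1<\dots<x_{N_x+1}=1$, $-1=y_0<\dots<y_{N_y+1}=1$, $h_{x,i}=x_{i+1}-x_i$, $h_{y,j}=y_{j+1}-y_j$. The degeneracy function $\sigma(x,y)\ge0$ on $\overline{\mathcal{D}}$ vanishes only on a subset of $\partial\mathcal{D}$, and $\sigma_{i,j}=\sigma(x_i,y_j)$. Grid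 vectors $(u_{1,1},u_{2,1},\dots,u_{N_x,1},u_{1,2},\dots,u_{N_x,N_y})^{T}\in\mathbb{R}^{N_xN_y}$ are ordered lexicographically. Matrices: $B=\mathrm{diag}(\sigma_{1,1}^{-1},\sigma_{2,1}^{-1},\dots,\sigma_{N_x,1}^{-1},\sigma_{1,2}^{-1},\dots,\sigma_{N_x,N_y}^{-1})$. For $\alpha\in\{x,y\}$, $T_\alpha\in\mathbb{R}^{N_\alpha\times N_\alpha}$ is tridiagonal with $(T_\alpha)_{i,i}=-\frac{2}{h_{\alpha,i-1}h_{\alpha,i}}$, $(T_\alpha)_{i,i+1}=\frac{2}{h_{\alpha,i}(h_{\alpha,i-1}+h_{\alpha,i})}$, $(T_\alpha)_{i+1,i}=\frac{2}{h_{\alpha,i}(h_{\alpha,i}+h_{\alpha,i+1})}$. $M_x=a^{-2}B(I_{N_y}\otimes T_x)$, $M_y=b^{-2}B(T_y\otimes I_{N_x})$, $M=M_x+M_y$. With $E(A)=e^{A}$ the matrix exponential, $\Phi_{x,k}=E(\tau_kM_x/2)$, $\Phi_{y,k}=E(\tau_kM_y)$, $\Phi_k=\Phi_{x,k}\Phi_{y,k}\Phi_{x,k}$. Reaction term: $g(\varepsilon,u)=f(\varepsilon,u)/\sigma(x,y)$ with a bounded stochastic influence $\varepsilon(x,y)$, where for $u\in[0,1)$: $f(\varepsilon,0)=f_0(\varepsilon)>0$, $f_u(\varepsilon,u)>0$, $\lim_{u\to1^-}f(\varepsilon,u)=\infty$, $\int_0^1f(\varepsilon,u)\,du=\infty$,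 and for each $u\in[0,1)$, $0<f^{\varepsilon}_{\min}\le\min_\varepsilon f(\varepsilon,u)$ and $\max_\varepsilon f(\varepsilon,u)\le f^{\varepsilon}_{\max}\ll\infty$. For a grid vector $v$, $g(\varepsilon,v)$ is a suitable discretization of this nonlinear stochastic reaction term. *)

(* Defs.v *)
From HB Require Import structures.
From mathcomp Require Import all_boot all_order all_algebra.
From mathcomp Require Import all_classical all_reals all_analysis.
From mathcomp Require Export mxtens.
Import Order.TTheory GRing.Theory Num.Theory.
Import numFieldNormedType.Exports.

Set Implicit Arguments.
Unset Strict Implicit.
Unset Printing Implicit Defensive.

Local Open Scope classical_set_scope.
Local Open Scope ring_scope.

(* Componentwise relations between column vectors. *)
Definition vle (R : realType) (n : nat) (u v : 'cV[R]_n) : Prop :=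
  forall i, u i 0 <= v i 0.

Definition vlt (R : realType) (n : nat) (u v : 'cV[R]_n) : Prop :=
  forall i, u i 0 < v i 0.

Definition in_unit_box (R : realType) (n : nat) (v : 'cV[R]_n) : Prop :=
  vle 0 v /\ vlt v (const_mx 1).

(* E(A) = sum_k A^k / k!, the limit being taken in the space of matrices. *)
Definition expmx (R : realType) (n : nat) (A : 'M[R]_n) : 'M[R]_n :=
  lim (series (fun k => (k`!%:R)^-1 *: (A ^+ k)) @ \oo).

(* The nodes x_0 < x_1 < ... < x_(N+1) of [-1, 1]; the values x_i with
   i > N + 1 are irrelevant. *)
Definition mesh (R : realType) (N : nat) (x : nat -> R) : Prop :=
  [/\ x 0%N = -1, x N.+1 = 1 & forall i, (i <= N)%N -> x i < x i.+1].

Definition spacing (R : realType) (x : nat -> R) (i : nat) : R :=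
  x i.+1 - x i.

(* The matrix index i : 'I_N stands for the interior node x_(i+1), so that its
   left and right spacings are h_i and h_(i+1). *)
Definition Tmx (R : realType) (N : nat) (x : nat -> R) : 'M[R]_N :=
  let h := spacing x in
  \matrix_(i < N, j < N)
    if j == i then - (2 / (h i * h i.+1))
    else if (j == i.+1 :> nat) then 2 / (h i.+1 * (h i + h i.+1))
    else if (i == j.+1 :> nat) then 2 / (h j.+1 * (h j.+1 + h j.+2))
    else 0.

(* Grid vectors are indexed by 'I_(Ny * Nx): mxtens_unindex k = (j, i), with
   k = j * Nx + i, is the interior node (x_(i+1), y_(j+1)).  This is the
   lexicographic order with the x index running fastest, and it is the index
   convention of the Kronecker product *t. *)
Definition grid_x (R : realType) (Nx Ny : nat) (x : nat -> R)
  (k : 'I_(Ny * Nx)) : R := x (mxtens_unindex k).2.+1.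

Definition grid_y (R : realType) (Nx Ny : nat) (y : nat -> R)
  (k : 'I_(Ny * Nx)) : R := y (mxtens_unindex k).1.+1.

Definition Bmx (R : realType) (Nx Ny : nat) (x y : nat -> R)
  (sigma : R -> R -> R) : 'M[R]_(Ny * Nx) :=
  diag_mx (\row_k (sigma (grid_x x k) (grid_y y k))^-1).

Definition Mxmx (R : realType) (Nx Ny : nat) (x y : nat -> R)
  (sigma : R -> R -> R) (a : R) : 'M[R]_(Ny * Nx) :=
  a ^- 2 *: (Bmx Nx Ny x y sigma *m ((1%:M : 'M[R]_Ny) *t Tmx Nx x)).

Definition Mymx (R : realType) (Nx Ny : nat) (x y : nat -> R)
  (sigma : R -> R -> R) (b : R) : 'M[R]_(Ny * Nx) :=
  b ^- 2 *: (Bmx Nx Ny x y sigma *m (Tmx Ny y *t (1%:M : 'M[R]_Nx))).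

Definition Phimx (R : realType) (n : nat) (Mx My : 'M[R]_n) (tau : R)
  : 'M[R]_n :=
  expmx ((tau / 2) *: Mx) *m expmx (tau *: My) *m expmx ((tau / 2) *: Mx).

Definition degeneracy (R : realType) (sigma : R -> R -> R) : Prop :=
  forall x y, -1 <= x <= 1 -> -1 <= y <= 1 ->
    0 <= sigma x y /\ (sigma x y = 0 -> `|x| = 1 \/ `|y| = 1).

(* F is differentiable at u relative to [0, 1), with derivative l: this is the
   right derivative at 0, since F carries no information outside [0, 1). *)
Definition is_derive01 (R : realType) (F : R -> R) (u l : R) : Prop :=
  h^-1 * (F (u + h) - F u) @[h --> within [set h | 0 <= u + h < 1] 0^'] --> l.

(* The assumptions on f(e, u), for e in the set E of values of the noise. *)
Definition reaction (R : realType) (E : set R) (f : R -> R -> R) : Prop :=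
  [/\ forall e, E e -> 0 < f e 0,
      forall e u, E e -> 0 <= u < 1 ->
        exists l, is_derive01 (f e) u l /\ 0 < l,
      forall e, E e -> f e u @[u --> 1^'-] --> +oo,
      forall e, E e ->
        (\int[lebesgue_measure]_(u in `[0%R, 1%R[) (f e u)%:E)%E = +oo%E &
      forall u, 0 <= u < 1 -> exists fmin fmax, 0 < fmin /\
        forall e, E e -> fmin <= f e u <= fmax].

(* g(eps, v) = f(eps, v) / sigma at the interior grid points. *)
Definition gvec (R : realType) (Nx Ny : nat) (x y : nat -> R)
  (sigma f eps : R -> R -> R) (v : 'cV[R]_(Ny * Nx)) : 'cV[R]_(Ny * Nx) :=
  \col_k (f (eps (grid_x x k) (grid_y y k)) (v k 0) /
          sigma (grid_x x k) (grid_y y k)).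

(* v solves the scheme with the steps tau.  As g(eps, w) has a meaning for
   0 <= w < 1 only, a solution v_(k+1) has to lie there when it is an argument
   of g in its own equation, that is, unless theta = 1.  For theta = 1 the
   equation is an explicit formula for v_(k+1), which is then unrestricted. *)
Definition scheme_solution (R : realType) (n : nat) (Mx My : 'M[R]_n)
  (g : 'cV[R]_n -> 'cV[R]_n) (theta : R) (tau : nat -> R)
  (v : nat -> 'cV[R]_n) : Prop :=
  let M := Mx + My in
  forall k,
    let Phi := Phimx Mx My (tau k) in
    v k.+1 = Phi *m v k +
      invmx M *m (Phi - 1%:M) *m (theta *: g (v k) + (1 - theta) *: g (v k.+1))
    /\ (theta < 1 -> in_unit_box (v k.+1)).

(* Main.v *)
Require Import Defs.
From HB Require Import structures.
From mathcomp Require Import all_boot all_order all_algebra.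
From mathcomp Require Import all_classical all_reals all_analysis.
From mathcomp Require Import ring lra zify.
From mathcomp Require complex.
Import Order.TTheory GRing.Theory Num.Theory.
Import numFieldNormedType.Exports.

Set Implicit Arguments.
Unset Strict Implicit.
Unset Printing Implicit Defensive.

Local Open Scope classical_set_scope.
Local Open Scope ring_scope.

(** The invariant of the scheme is M v + g(v) > 0.  Let w be a solution of one
    step of length t from v, let h be the weighted reaction
    theta g(v) + (1 - theta) g(w), and put q = M v + h and z = w - v.  The
    symmetric splitting Phi agrees with exp(t M) up to O(t^3), so that
    M^-1 (Phi - I) = t I + (t^2/2) M + O(t^3) ([propagator_expansion]).  This gives
    z = t q + (t/2) M z + O(t^2) as soon as v and w lie in the unit box, with an
    error that does not depend on the size of the reaction, which is unbounded
    near 1 ([step_expansion_implicit]).  Since the off-diagonal entries of M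
    are nonnegative and g is nondecreasing, it follows that z is positive for
    t > 0, and that M w + g(w) > 0 again, when t is below a bound given by v only
    ([step_increasing]).  The matrix M is invertible because 1 - x^2 is a strict
    supersolution of the discrete Dirichlet problem ([M_unitmx]).

    It remains to solve the implicit equation ([exists_step]).  The function f
    is differentiable, but its derivative may be unbounded near v, so that the
    equation need not be a contraction for any t; and the terms of third order
    in M^-1 (Phi - I) have no definite sign, so that it need not be monotone.
    It is a fixed point problem w = c + A g(w) in which g acts on each component
    separately, and Brouwer's theorem is proved for such maps
    ([separable_fixpoint]): truncate g to a bounded function, approximate it by
    polynomials ([weierstrass]) and add a small multiple of a high odd power D of
    each unknown.  The resulting polynomial system defines an algebra of odd
    dimension D^n, in which the commuting multiplications by the unknowns have a
    common real eigenvector ([odd_separable_system]). *)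

(** * Polynomial systems of odd degree *)

(** Monomials in n variables are represented by their exponent vectors; this is
    the one of the m-th power of the j-th variable. *)
Definition varexp n (m : nat) (j : 'I_n) : {ffun 'I_n -> nat} :=
  [ffun k => if k == j then m else 0%N].

Definition mdegree n (e : {ffun 'I_n -> nat}) : nat := (\sum_i e i)%N.

Lemma mdegreeD n (e e' : {ffun 'I_n -> nat}) :
  mdegree (e + e') = (mdegree e + mdegree e')%N.
Proof. by rewrite /mdegree -big_split; apply: eq_bigr => i _; rewrite ffunE. Qed.

Lemma mdegree_varexp n m (j : 'I_n) : mdegree (varexp m j) = m.
Proof.
rewrite /mdegree (bigD1 j) //= ffunE eqxx big1 ?addn0 // => i /negPf ij.
by rewrite ffunE ij.
Qed.

Lemma varexp_split n D (e : {ffun 'I_n -> nat}) i :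
  (D <= e i)%N -> exists e', e = e' + varexp D i.
Proof.
move=> De; exists [ffun k => (e k - varexp D i k)%N]; apply/ffunP => k.
rewrite !ffunE; case: eqP => [->|_]; first by rewrite -[LHS](subnK De).
by rewrite subn0 -[LHS]addn0.
Qed.

(** Normal form of a monomial modulo the relations x_i^D = sum_j P_ij(x_j), as
    a combination of the images b of the monomials with all exponents below D.
    Each reduction lowers the total degree, which is the fuel needed. *)
Fixpoint reduce_monomial (R : nzRingType) (V : lmodType R) n D (P : 'I_n -> 'I_n -> {poly R})
    (b : {ffun 'I_n -> nat} -> V) (fuel : nat)
    (e : {ffun 'I_n -> nat}) : V :=
  if [pick i | (D <= e i)%N] is Some i then
    if fuel is k.+1 then
      \sum_j \sum_(m < D) (P i j)`_m *:
        reduce_monomial D P b k ([ffun l => (e l - varexp D i l)%N] + varexp m j)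
    else 0
  else b e.

(** The normal form does not depend on the order of the reductions: when two
    variables can be reduced, either reduction leaves the other one possible,
    so both lead to the same result by induction on the degree: the leading terms
    x_i^D are powers of distinct variables, and two reductions act on disjoint
    factors of the monomial. *)
Lemma normal_form (R : comNzRingType) (V : lmodType R) n D
    (P : 'I_n -> 'I_n -> {poly R}) (b : {ffun 'I_n -> nat} -> V) :
  (0 < D)%N ->
  exists N : {ffun 'I_n -> nat} -> V,
    (forall e : {ffun 'I_n -> nat}, (forall i, e i < D)%N -> N e = b e) /\
    forall e i, N (e + varexp D i) =
      \sum_j \sum_(m < D) (P i j)`_m *: N (e + varexp m j).
Proof.
move=> D0.
have monoK (e : {ffun 'I_n -> nat}) i :
      [ffun l => ((e + varexp D i)%R l - varexp D i l)%N] = e.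
  by apply/ffunP => l; rewrite !ffunE -[RHS](addnK (varexp D i l)) ffunE.
have monoI (e e' : {ffun 'I_n -> nat}) i :
    e + varexp D i = e' + varexp D i -> e = e'.
  by move=> ee'; rewrite -(monoK e i) ee' monoK.
have fuel_indep : forall k k' e, (mdegree e <= k)%N -> (mdegree e <= k')%N ->
    reduce_monomial D P b k e = reduce_monomial D P b k' e.
  elim=> [|k IH] [|k'] e dk dk'; rewrite /=; case: pickP => // i Di.
  - have := dk; have [e' ->] := varexp_split Di.
    by rewrite mdegreeD mdegree_varexp leqn0 addn_eq0 andbC eqn0Ngt D0.
  - have := dk'; have [e' ->] := varexp_split Di.
    by rewrite mdegreeD mdegree_varexp leqn0 addn_eq0 andbC eqn0Ngt D0.
  - have [e' eE] := varexp_split Di; subst e; rewrite monoK.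
    apply: eq_bigr => j _; apply: eq_bigr => m _; congr (_ *: _).
    have lt_deg : (mdegree (e' + varexp m j)%R < mdegree (e' + varexp D i)%R)%N.
      by rewrite !mdegreeD !mdegree_varexp ltn_add2l.
    by apply: IH; rewrite -ltnS; apply: leq_trans lt_deg _.
pose N e := reduce_monomial D P b (mdegree e) e.
have N_reduced (e : {ffun 'I_n -> nat}) : (forall i, e i < D)%N -> N e = b e.
  move=> De; rewrite /N; case: (mdegree e) => [|k] /=;
  by case: pickP => // i; rewrite leqNgt De.
have N_pick (e : {ffun 'I_n -> nat}) : (exists i, D <= e i)%N -> exists i e', e = e' + varexp D i /\
    N e = \sum_j \sum_(m < D) (P i j)`_m *: N (e' + varexp m j).
  case=> i0 Di0.
  have e0 : (0 < mdegree e)%N.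
    have [e' ->] := varexp_split Di0.
    by rewrite mdegreeD mdegree_varexp addn_gt0 D0 orbT.
  rewrite /N -(prednK e0) /=; case: pickP => [i Di|]; last first.
    by move/(_ i0); rewrite Di0.
  have [e' eE] := varexp_split Di; subst e; exists i, e'; split=> //.
  rewrite monoK; apply: eq_bigr => j _; apply: eq_bigr => m _; congr (_ *: _).
  apply: fuel_indep => //; rewrite -ltnS prednK //.
  by rewrite !mdegreeD !mdegree_varexp ltn_add2l.
exists N; split=> // e i.
have [k] := ubnP (mdegree (e + varexp D i)).
elim: k e i => // k IH e i; rewrite ltnS => dk.
(* i' is the variable that the definition of N reduces first *)
have [|i' [e' [ee' ->]]] := N_pick (e + varexp D i).
  by exists i; rewrite !ffunE eqxx leq_addl.
have [ii'|ii'] := eqVneq i' i.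
  by subst i'; rewrite (monoI _ _ _ ee').
have [e'' e'E] : exists e'', e' = e'' + varexp D i.
  apply: varexp_split.
  have : (e + varexp D i) i = (e' + varexp D i') i by rewrite ee'.
  rewrite !ffunE eqxx eq_sym (negPf ii') => E.
  by have := leq_addl (e i) D; rewrite [X in (_ <= X)%N -> _]E; congr leq; rewrite addr0.
subst e'.
have eE : e = e'' + varexp D i'.
  by apply: (@monoI _ _ i); rewrite ee' addrAC.
subst e.
transitivity (\sum_j \sum_(m < D) (P i' j)`_m *:
   \sum_j' \sum_(m' < D) (P i j')`_m' *: N (e'' + varexp m j + varexp m' j')).
  apply: eq_bigr => j _; apply: eq_bigr => m _; congr (_ *: _).
  rewrite addrAC IH //; apply: leq_trans dk.
  by rewrite !mdegreeD !mdegree_varexp ltn_add2r ltn_add2l.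
transitivity (\sum_j' \sum_(m' < D) (P i j')`_m' *:
   \sum_j \sum_(m < D) (P i' j)`_m *: N (e'' + varexp m' j' + varexp m j)); last first.
  apply: eq_bigr => j _; apply: eq_bigr => m _; congr (_ *: _).
  rewrite [in RHS]addrAC IH //; apply: leq_trans dk.
  by rewrite !mdegreeD !mdegree_varexp ltn_add2r ltn_add2l.
under eq_bigr => j _ do under eq_bigr => m _ do rewrite scaler_sumr.
under eq_bigr => j _ do under eq_bigr => m _ do under eq_bigr => j' _ do rewrite scaler_sumr.
under [RHS]eq_bigr => j _ do under eq_bigr => m _ do rewrite scaler_sumr.
under [RHS]eq_bigr => j _ do under eq_bigr => m _ do under eq_bigr => j' _ do rewrite scaler_sumr.
under eq_bigr => j _ do rewrite exchange_big.
rewrite exchange_big /=; apply: eq_bigr => j' _.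
under eq_bigr => j _ do rewrite exchange_big.
rewrite exchange_big /=; apply: eq_bigr => m' _.
apply: eq_bigr => j _; apply: eq_bigr => m _.
by rewrite !scalerA mulrC [in LHS]addrAC.
Qed.

(** The algebra R[x_1, .., x_n] / (x_i^D - sum_j P_ij(x_j)) has the D^n monomials
    with exponents below D as a basis, hence an odd dimension.  Commuting
    endomorphisms of a real vector space of odd dimension have a common
    eigenvector; for the multiplications by the variables, its eigenvalues are
    the coordinates of a real solution. *)
Lemma odd_separable_system (R : rcfType) n D (P : 'I_n -> 'I_n -> {poly R}) :
  odd D -> (forall i j, size (P i j) <= D)%N ->
  exists s : 'I_n -> R, forall i, s i ^+ D = \sum_j (P i j).[s j].
Proof.
move=> oddD sizeP.
have D0 : (0 < D)%N by case: D oddD {sizeP}.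
pose S := {ffun 'I_n -> 'I_D}.
pose basis (e : {ffun 'I_n -> nat}) : 'rV[R]_#|S| :=
  delta_mx 0 (enum_rank [ffun i => insubd (Ordinal D0) (e i)]).
pose expo (s : S) : {ffun 'I_n -> nat} := [ffun i => val (s i)].
have [N [N_reduced N_rule]] := normal_form P basis D0.
have N_expo s : N (expo s) = delta_mx 0 (enum_rank s).
  rewrite N_reduced => [|i]; last by rewrite ffunE ltn_ord.
  congr delta_mx; congr enum_rank; apply/ffunP => i.
  by rewrite !ffunE valKd.
(* multiplication by the i-th variable in the quotient algebra *)
pose X i : 'M[R]_#|S| := \matrix_r N (expo (enum_val r) + varexp 1 i).
have mulX e i : N e *m X i = N (e + varexp 1 i).
  have [k] := ubnP (mdegree e); elim: k e => // k IH e; rewrite ltnS => dk.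
  have [/forallP red|] := boolP [forall i, e i < D]%N.
    pose s : S := [ffun i => Ordinal (red i)].
    have -> : e = expo s by apply/ffunP => j; rewrite !ffunE.
    by rewrite N_expo -rowE rowK enum_rankK.
  rewrite negb_forall => /existsP[j]; rewrite -leqNgt => Dj.
  have [e' eE] := varexp_split Dj; subst e; rewrite N_rule addrAC N_rule.
  rewrite mulmx_suml; apply: eq_bigr => l _.
  rewrite mulmx_suml; apply: eq_bigr => m _.
  rewrite -scalemxAl [in RHS]addrAC IH //; apply: leq_trans dk.
  by rewrite !mdegreeD !mdegree_varexp ltn_add2l.
have commX i j : X i *m X j = X j *m X i.
  apply/row_matrixP => r; rewrite !row_mul !rowK !mulX.
  by rewrite [in LHS]addrAC.
have oddS : ~~ (2 %| \rank (1%:M : 'M[R]_#|S|))%N.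
  by rewrite mxrank1 dvdn2 negbK card_ffun !card_ord oddX oddD orbT.
(* the identity makes the list nonempty when n = 0 *)
pose Xs : seq 'M[R]_#|S| := 1%:M :: [seq X i | i : 'I_n].
have mem_Xs i : X i \in Xs by rewrite inE map_f ?orbT // mem_enum.
have [] := @complex.Lemma4 R (size Xs).-1 _ 1%:M oddS Xs.
- by [].
- by move=> f _ /=; rewrite submx1.
- move=> f g; rewrite !inE => /orP[/eqP->|/mapP[i _ ->]];
  by move=> /orP[/eqP->|/mapP[j _ ->]]; rewrite ?mul1mx ?mulmx1.
move=> v v0 eigenX.
have eigen i : exists a, v *m X i = a *: v.
  by have [a /eigenspaceP] := eigenX _ (mem_Xs i); exists a.
pose s i := projT1 (cid (eigen i)).
have sE i : v *m X i = s i *: v by rewrite /s; case: cid.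
exists s => i.
(* the product of v with the monomial of exponent e *)
pose L e := \sum_r v 0 r *: N (expo (enum_val r) + e).
have L_mono m j : L (varexp m j) = s j ^+ m *: v.
  elim: m => [|m IH].
    rewrite expr0 scale1r [v in RHS]row_sum_delta /L; apply: eq_bigr => r _.
    rewrite (_ : varexp 0 j = 0) ?addr0 ?N_expo ?enum_valK //.
    by apply/ffunP => k; rewrite !ffunE if_same.
  rewrite exprS mulrC -scalerA -sE scalemxAl -IH /L mulmx_suml.
  apply: eq_bigr => r _; rewrite -scalemxAl mulX -addrA; congr (_ *: N (_ + _)).
  by apply/ffunP => k; rewrite !ffunE; case: eqP => // _; rewrite -[LHS]addn1.
have : s i ^+ D *: v = (\sum_j (P i j).[s j]) *: v.
  rewrite -L_mono /L.
  under eq_bigr => r _ do rewrite N_rule scaler_sumr.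
  rewrite exchange_big /= scaler_suml; apply: eq_bigr => j _.
  rewrite (horner_coef_wide _ (sizeP i j)) scaler_suml.
  under eq_bigr => r _ do rewrite scaler_sumr.
  rewrite exchange_big /=; apply: eq_bigr => m _.
  rewrite -scalerA -L_mono /L scaler_sumr; apply: eq_bigr => r _.
  by rewrite !scalerA mulrC.
move/eqP; rewrite -subr_eq0 -scalerBl scaler_eq0 (negPf v0) orbF subr_eq0.
by move/eqP.
Qed.

(** * The Weierstrass approximation theorem *)

(** A modulus of continuity quadratic in s - x becomes a variance when it is
    averaged over a binomial variable s. *)
Lemma continuous_quadratic_modulus (R : realType) (f : R -> R) (e : R) :
  continuous f -> 0 < e ->
  exists2 C, 0 <= C &
    forall s x, 0 <= s <= 1 -> 0 <= x <= 1 -> `|f s - f x| <= e + C * (s - x) ^+ 2.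
Proof.
move=> cf e0.
have [c _ fc] : exists2 c, c \in `[0, 1] & forall x, x \in `[0, 1] -> `|f x| <= `|f c|.
  apply: (@EVT_max R (fun x => `|f x|)) ler01 _.
  apply: continuous_subspaceT => x.
  by apply: continuous_comp; [exact: cf|exact: norm_continuous].
pose B := `|f c|.
have {}fc x : 0 <= x <= 1 -> `|f x| <= B by exact: fc.
have B0 : 0 <= B by exact: normr_ge0.
have unif : \forall d \near 0^'+, `[(0 : R), 1]%classic `<=`
    [set x | forall s, `|s - x| < d -> `|f s - f x| < e].
  have /compact_near_coveringP := @segment_compact R 0 1; apply.
  move=> x _.
  have e2 : 0 < e / 2 by lra.
  have /cvgrPdist_lt/(_ _ e2)/nbhs_ballP[d /= d0 fd] := cf x.
  near=> y r => s /= sr.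
  have yx : `|x - y| < d / 2.
    near: y; apply/nbhs_ballP; exists (d / 2) => //=; first by rewrite divr_gt0.
  have rd : r < d / 2 by near: r; apply: nbhs_right_lt; rewrite divr_gt0.
  have fy : `|f x - f y| < e / 2 by apply: fd; rewrite /ball /=; lra.
  have fs : `|f x - f s| < e / 2.
    apply: fd; rewrite /ball /= (_ : x - s = (x - y) - (s - y)); last lra.
    by apply: le_lt_trans (ler_normB _ _) _; lra.
  rewrite (_ : f s - f y = (f x - f y) - (f x - f s)); last lra.
  by apply: le_lt_trans (ler_normB _ _) _; lra.
have [d [d0 dP]] : exists d, 0 < d /\ `[(0 : R), 1]%classic `<=`
    [set x | forall s, `|s - x| < d -> `|f s - f x| < e].
  near (0 : R)^'+ => d; exists d; split => //.
  by near: d; exact: unif.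
exists (2 * B / d ^+ 2) => [|s x s01 x01].
  by rewrite divr_ge0 ?sqr_ge0 ?mulr_ge0.
have [sx|sx] := ltP `|s - x| d.
  apply: le_trans (ltW (dP x _ _ sx)) _ => //=.
  by rewrite lerDl mulr_ge0 ?sqr_ge0 // divr_ge0 ?sqr_ge0 // mulr_ge0.
have : 2 * B <= 2 * B / d ^+ 2 * (s - x) ^+ 2.
  rewrite -[leLHS]mulr1 -[leRHS]mulrA ler_wpM2l ?mulr_ge0 // mulrC.
  rewrite ler_pdivlMr ?exprn_gt0 // mul1r -[leRHS]real_normK ?num_real //.
  by rewrite lerXn2r // nnegrE ltW.
have := ler_normB (f s) (f x); have := fc _ s01; have := fc _ x01; lra.
Unshelve. all: by end_near.
Qed.

(** The Bernstein polynomial sum_k 'C(N, k) f(k) X^k (1 - X)^(N - k), given by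
    de Casteljau's recursion: conditioning a binomial variable on its first
    trial avoids all binomial identities. *)
Fixpoint bernstein (R : nzRingType) N (f : nat -> R) : {poly R} :=
  if N is N'.+1 then
    'X * bernstein N' (f \o succn) + (1 - 'X) * bernstein N' f
  else (f 0%N)%:P.

Lemma bernsteinS (R : comNzRingType) N (f : nat -> R) x :
  (bernstein N.+1 f).[x] =
  x * (bernstein N (f \o succn)).[x] + (1 - x) * (bernstein N f).[x].
Proof. by rewrite /= !hornerE. Qed.

(** A binomial variable with parameters N and x has mean N x and variance
    N x (1 - x). *)
Lemma bernstein_variance (R : comNzRingType) N (c e a x : R) :
  (bernstein N (fun k => e + c * (k%:R - a) ^+ 2)).[x] =
  e + c * (N%:R * x * (1 - x) + (N%:R * x - a) ^+ 2).
Proof.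
elim: N a => [|N IH] a; first by rewrite /= hornerC; ring.
rewrite bernsteinS IH.
rewrite (_ : _ \o _ = fun k => e + c * (k%:R - (a - 1)) ^+ 2); last first.
  by apply/funext => k /=; rewrite -natr1; ring.
by rewrite IH -natr1; ring.
Qed.

Lemma bernstein_le (R : realDomainType) N (f g : nat -> R) x : 0 <= x <= 1 ->
  (forall k, (k <= N)%N -> f k <= g k) -> (bernstein N f).[x] <= (bernstein N g).[x].
Proof.
move=> /andP[x0 x1]; elim: N f g => [|N IH] f g fg.
  by rewrite /= !hornerC fg.
rewrite !bernsteinS lerD // ler_wpM2l ?subr_ge0 ?IH // => k kN; apply: fg => //.
exact: leqW.
Qed.

(** Bernstein's proof of the Weierstrass theorem, with Chebyshev's inequality
    replaced by the quadratic modulus. *)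
Lemma weierstrass01 (R : realType) (f : R -> R) (e : R) :
  continuous f -> 0 < e ->
  exists p : {poly R}, forall x, 0 <= x <= 1 -> `|p.[x] - f x| <= e.
Proof.
move=> cf e0; have e2 : 0 < e / 2 by lra.
have [C C0 fC] := continuous_quadratic_modulus cf e2.
have [N NP] : exists N, 2 * C / e < N.+1%:R.
  exists (Num.bound (2 * C / e)); apply: lt_trans (archi_boundP _) _.
    by rewrite divr_ge0 ?mulr_ge0 // ltW.
  by rewrite ltr_nat.
pose n := N.+1.
have n0 : (0 : R) < n%:R by rewrite ltr0n.
exists (bernstein n (fun k => f (k%:R / n%:R))) => x x01.
have shift r : r + C / n%:R ^+ 2 * (n%:R * x * (1 - x) + (n%:R * x - n%:R * x) ^+ 2)
    = r + C / n%:R * (x * (1 - x)).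
  by field; rewrite gt_eqF.
have small : C / n%:R * (x * (1 - x)) <= e / 2.
  have xx : 0 <= x * (1 - x) <= 1 by apply/andP; split; nra.
  have Cn : 0 <= C / n%:R <= e / 2.
    rewrite divr_ge0 ?(ltW n0) //= ler_pdivrMr //.
    move: NP; rewrite ltr_pdivrMr // => NP; rewrite -/n in NP; nra.
  by nra.
have kx k : (k <= n)%N -> `|f (k%:R / n%:R) - f x| <=
    e / 2 + C / n%:R ^+ 2 * (k%:R - n%:R * x) ^+ 2.
  move=> kn; apply: le_trans (fC _ _ _ x01) _.
    by rewrite divr_ge0 ?ler0n //= ler_pdivrMr // mul1r ler_nat.
  rewrite lerD2l le_eqVlt; apply/orP; left; apply/eqP; field.
  by rewrite gt_eqF.
rewrite ler_distl; apply/andP; split.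
  have := @bernstein_le R n
    (fun k => (f x - e / 2) + - (C / n%:R ^+ 2) * (k%:R - n%:R * x) ^+ 2)
    (fun k => f (k%:R / n%:R)) x x01.
  rewrite bernstein_variance => le_b.
  apply: le_trans (le_b _) => [|k kn].
    by have := shift 0; lra.
  by have := kx k kn; rewrite ler_norml; lra.
have := @bernstein_le R n (fun k => f (k%:R / n%:R))
  (fun k => (f x + e / 2) + (C / n%:R ^+ 2) * (k%:R - n%:R * x) ^+ 2) x x01.
rewrite bernstein_variance => le_b.
apply: le_trans (le_b _) _ => [k kn|]; first by have := kx k kn; rewrite ler_norml; lra.
by have := shift 0; lra.
Qed.

Lemma weierstrass (R : realType) (f : R -> R) (L e : R) :
  continuous f -> 0 < L -> 0 < e ->
  exists p : {poly R}, forall x, - L <= x <= L -> `|p.[x] - f x| <= e.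
Proof.
move=> cf L0 e0.
have cg : continuous (fun x : R => f (L * (2 * x - 1))).
  move=> x; apply: continuous_comp; last exact: cf.
  apply: cvgM; first exact: cvg_cst.
  by apply: cvgB; [apply: cvgM; [exact: cvg_cst|exact: cvg_id]|exact: cvg_cst].
have [p pP] := weierstrass01 cg e0.
exists (p \Po ((2 * L)^-1 *: ('X + L%:P))) => x xL.
have Lx : L * (2 * ((2 * L)^-1 * (x + L)) - 1) = x by field; rewrite gt_eqF.
rewrite horner_comp !hornerE -{2}Lx; apply: pP.
have L2 : 0 < 2 * L by lra.
by rewrite mulrC divr_ge0 ?ler_pdivrMr //=; lra.
Qed.

(** * A fixed point theorem for separable maps *)

Lemma horner_growth (R : realDomainType) (p : {poly R}) (d : nat) (L r x : R) :
  (size p <= d)%N -> 0 <= L -> 1 <= r -> `|x| <= L * r ->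
  `|p.[x]| <= (\sum_(m < d) `|p`_m| * L ^+ m) * r ^+ d.
Proof.
move=> sp L0 r1 xLr; rewrite (horner_coef_wide _ sp).
apply: le_trans (ler_norm_sum _ _ _) _; rewrite mulr_suml.
apply: ler_sum => m _; rewrite normrM -mulrA ler_wpM2l // normrX.
apply: le_trans (_ : (L * r) ^+ m <= _).
  by rewrite lerXn2r // nnegrE // mulr_ge0 // (le_trans ler01).
rewrite exprMn ler_wpM2l ?exprn_ge0 // ler_weXn2l //.
exact: ltnW.
Qed.

Lemma ex_expr_small (R : realType) (C e : R) : 0 < e ->
  exists N, forall M, (N <= M)%N -> C * (3 / 4) ^+ M <= e.
Proof.
move=> e0.
have q1 : `|3 / 4 : R| < 1 by rewrite ger0_norm; lra.
have [N _ NP] : \forall M \near \oo, `|C| * (3 / 4 : R) ^+ M <= e.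
  have /cvgrPdist_le/(_ (e / (`|C| + 1))) := cvg_expr q1.
  have C1 : 0 < `|C| + 1 by rewrite ltr_wpDl.
  rewrite divr_gt0 // => /(_ isT); apply: filterS => M.
  rewrite sub0r normrN ger0_norm ?exprn_ge0 ?divr_ge0 // ler_pdivlMr // => MP.
  apply: le_trans MP; rewrite mulrC ler_wpM2l ?exprn_ge0 ?divr_ge0 //.
  by rewrite lerDl.
exists N => M NM; apply: le_trans (NP _ NM).
by rewrite ler_wpM2r ?exprn_ge0 ?divr_ge0 // ler_norm.
Qed.

Definition affsum (R : pzRingType) n (A : 'M[R]_n) (c : 'I_n -> R)
  (phi : 'I_n -> R -> R) (s : 'I_n -> R) (i : 'I_n) : R :=
  c i + \sum_j A i j * phi j (s j).

(** On [-2b, 2b] the phi_j are close to polynomials.  Adding eta s_i^D with D odd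
    and large turns the polynomial fixed point equation into a monic system of
    odd degree, which has a real solution s.  Let C r^d bound the polynomial map
    on the box of radius 2b r, for r >= 1.  With eta = C / (2b)^D, the term
    eta s_i^D dominates the map outside the box of radius 2b, which keeps s
    inside it; then |s_i| <= 3b/2, where eta s_i^D is at most C (3/4)^D and
    hence negligible. *)
Lemma approx_separable_fixpoint (R : realType) n (A : 'M[R]_n) (c : 'I_n -> R)
    (phi : 'I_n -> R -> R) (b : R) (e : R) :
  (forall j, continuous (phi j)) -> 0 < b ->
  (forall s i, `|affsum A c phi s i| <= b) -> 0 < e ->
  exists s : 'I_n -> R, forall i,
    `|s i| <= 2 * b /\ `|s i - affsum A c phi s i| <= e.
Proof.
move=> cphi b0 phib; wlog eb : e / e <= b => [wlg e0|e0].
  have [||s sP] := wlg (Num.min e b).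
  - by rewrite ge_min lexx orbT.
  - by rewrite lt_min e0.
  - exists s => i; have [si] := sP i; rewrite le_min => /andP[] //.
pose L := 2 * b; have L0 : 0 < L by rewrite /L; lra.
pose a := 1 + \sum_i \sum_j `|A i j|.
have a0 : 0 < a by rewrite ltr_wpDr // sumr_ge0 // => i _; rewrite sumr_ge0.
have Aa i : \sum_j `|A i j| <= a.
  rewrite /a [in leRHS](bigD1 i) //= addrCA lerDl ler_wpDr // sumr_ge0 // => k _.
  by rewrite sumr_ge0.
have [p pP] : exists p : 'I_n -> {poly R}, forall j x,
    - L <= x <= L -> `|(p j).[x] - phi j x| <= e / (2 * a).
  have pj j : exists q : {poly R}, forall x,
      - L <= x <= L -> `|q.[x] - phi j x| <= e / (2 * a).
    by apply: weierstrass => //; rewrite divr_gt0 // mulr_gt0.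
  by exists (fun j => projT1 (cid (pj j))) => j; case: cid.
pose q j x := (p j).[x].
have qphi s i : (forall j, `|s j| <= L) ->
    `|affsum A c q s i - affsum A c phi s i| <= e / 2.
  move=> sL; rewrite /affsum opprD addrACA subrr add0r -sumrB.
  apply: le_trans (ler_norm_sum _ _ _) _.
  apply: le_trans (_ : \sum_j `|A i j| * (e / (2 * a)) <= _).
    apply: ler_sum => j _; rewrite -mulrBr normrM ler_wpM2l //.
    by apply: pP; rewrite -ler_norml.
  rewrite -mulr_suml; apply: le_trans (_ : a * (e / (2 * a)) <= _).
    by rewrite ler_wpM2r // divr_ge0 ?mulr_ge0 ?ltW.
  by rewrite le_eqVlt; apply/orP; left; apply/eqP; field; rewrite gt_eqF.
pose d := (\max_j size (p j))%N.
have size_p j : (size (p j) <= d)%N by exact: leq_bigmax.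
pose C := 1 + \sum_i (`|c i| + \sum_j `|A i j| * \sum_(m < d) `|(p j)`_m| * L ^+ m).
have coef_ge0 j : 0 <= \sum_(m < d) `|(p j)`_m| * L ^+ m.
  by rewrite sumr_ge0 // => m _; rewrite mulr_ge0 // exprn_ge0 // ltW.
have Ci_ge0 i : 0 <= `|c i| + \sum_j `|A i j| * \sum_(m < d) `|(p j)`_m| * L ^+ m.
  by rewrite addr_ge0 // sumr_ge0 // => j _; rewrite mulr_ge0.
have C0 : 0 < C by rewrite ltr_wpDr // sumr_ge0.
have q_growth s i r : 1 <= r -> (forall j, `|s j| <= L * r) ->
    `|affsum A c q s i| < C * r ^+ d.
  move=> r1 sLr; have r0 : 0 < r by exact: lt_le_trans ltr01 r1.
  have rd0 : 0 < r ^+ d by rewrite exprn_gt0.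
  have rd1 : 1 <= r ^+ d by rewrite exprn_ege1.
  apply: le_lt_trans (_ : _ <= (C - 1) * r ^+ d) _; last first.
    by rewrite ltr_pM2r // ltrBlDr ltrDl.
  rewrite /C addrAC subrr add0r (bigD1 i) //= mulrDl ler_wpDr //.
    by rewrite mulr_ge0 ?(ltW rd0) // sumr_ge0.
  apply: le_trans (ler_normD _ _) _; rewrite mulrDl lerD //.
    by rewrite ler_peMr.
  apply: le_trans (ler_norm_sum _ _ _) _; rewrite mulr_suml ler_sum // => j _.
  by rewrite normrM -mulrA ler_wpM2l // horner_growth // ltW.
have e2 : 0 < e / 2 by lra.
have [N NP] := ex_expr_small C e2.
pose k := (N + d).+1; pose D := k.*2.+1.
have dD : (d <= D)%N by rewrite /D /k -addnn; lia.
have ND : (N <= D)%N by rewrite /D /k -addnn; lia.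
pose eta := C / L ^+ D.
have eta0 : 0 < eta by rewrite divr_gt0 // exprn_gt0.
have eta_neq0 : eta != 0 by rewrite gt_eqF.
pose P i j : {poly R} :=
  eta^-1 *: (A i j *: p j + (i == j)%:R *: ((c i)%:P - 'X)).
have [||s sP] := @odd_separable_system R n D P.
- by rewrite /D /= odd_double.
- move=> i j; apply: leq_trans (size_scale_leq _ _) _.
  apply: leq_trans (size_polyD _ _) _; rewrite geq_max.
  rewrite (leq_trans (size_scale_leq _ _)) ?(leq_trans (size_p j)) //=.
  apply: leq_trans (size_scale_leq _ _) _.
  by rewrite -opprB size_polyN size_XsubC /D /k doubleS.
have even_part i : 0 <= (s i ^+ 2) ^+ k by rewrite exprn_ge0 // sqr_ge0.
have {}sP i : s i * (1 + eta * (s i ^+ 2) ^+ k) = affsum A c q s i.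
  have := sP i; rewrite /D exprS -mul2n exprM => eq_s.
  rewrite mulrDr mulr1 mulrCA eq_s mulr_sumr.
  rewrite (eq_bigr (fun j => A i j * (p j).[s j] + (i == j)%:R * (c i - s j))).
    rewrite big_split /= (bigD1 i (F := fun j => _ * (c i - s j))) //= eqxx mul1r.
    rewrite [X in _ + (_ + (_ + X))]big1 => [|j ij]; last by rewrite eq_sym (negPf ij) mul0r.
    by rewrite /affsum /q; ring.
  by move=> j _; rewrite /P hornerZ mulVKf ?eta_neq0 // !hornerE.
have abs_pow i : `|s i| * (s i ^+ 2) ^+ k = `|s i| ^+ D.
  by rewrite -[s i ^+ 2]real_normK ?num_real // -exprM mul2n -exprS.
have abs_sP i : `|affsum A c q s i| = `|s i| + C * (`|s i| / L) ^+ D.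
  rewrite -sP normrM [X in _ * X]ger0_norm; last by rewrite addr_ge0 // mulr_ge0 // ltW.
  by rewrite mulrDr mulr1 expr_div_n -abs_pow /eta; congr (_ + _); ring.
have sL i : `|s i| < L.
  rewrite ltNge; apply/negP => Li.
  pose i0 := [arg max_(j > i) `|s j|]%O.
  have i0P j : `|s j| <= `|s i0|.
    by rewrite /i0; case: arg_maxP => //= l _ /(_ j isT).
  have := @q_growth s i0 (`|s i0| / L).
  rewrite ler_pdivlMr // mul1r (le_trans Li) // => /(_ isT).
  rewrite mulrCA divff ?gt_eqF // mulr1 => /(_ i0P); rewrite abs_sP.
  apply/negP; rewrite -leNgt ler_wpDl // ler_pM2l //.
  by rewrite ler_weXn2l // ler_pdivlMr // mul1r (le_trans Li).
have sq i : `|s i - affsum A c phi s i| <= e.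
  have q_phi := @qphi s i (fun j => ltW (sL j)).
  have q_le : `|affsum A c q s i| <= 3 / 2 * b.
    have := phib s i; have := ler_normD (affsum A c q s i - affsum A c phi s i) (affsum A c phi s i).
    rewrite subrK; lra.
  have ratio0 : 0 <= `|s i| / L by rewrite divr_ge0 // ltW.
  have s_small : `|s i| / L <= 3 / 4.
    rewrite ler_pdivrMr // /L; move: q_le; rewrite abs_sP => q_le.
    have : 0 <= C * (`|s i| / L) ^+ D by rewrite mulr_ge0 ?exprn_ge0 // ltW.
    lra.
  have corr : C * (`|s i| / L) ^+ D <= e / 2.
    apply: le_trans (NP _ ND); rewrite ler_wpM2l ?(ltW C0) //.
    by rewrite lerXn2r // nnegrE; lra.
  have : `|s i - affsum A c q s i| <= e / 2.
    rewrite -sP mulrDr mulr1 opprD addrA subrr sub0r normrN.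
    rewrite (_ : `|_| = C * (`|s i| / L) ^+ D) //.
    rewrite normrM [`|eta * _|]ger0_norm; last by rewrite mulr_ge0 // ltW.
    by rewrite expr_div_n -abs_pow /eta; ring.
  have := ler_normD (s i - affsum A c q s i) (affsum A c q s i - affsum A c phi s i).
  rewrite addrA subrK; lra.
by exists s => i; split; [exact: ltW (sL i)|exact: sq].
Qed.

(** Brouwer's theorem for the maps s |-> c + A phi(s) in which phi acts on each
    coordinate separately: the distance between a point and its image attains
    its minimum on a compact box, and this minimum is 0 by
    [approx_separable_fixpoint]. *)
Lemma separable_fixpoint (R : realType) n (A : 'M[R]_n) (c : 'I_n -> R)
    (phi : 'I_n -> R -> R) (b : R) :
  (forall j, continuous (phi j)) -> (forall j x, `|phi j x| <= b) ->
  exists s : 'I_n -> R, forall i, s i = affsum A c phi s i.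
Proof.
move=> cphi phib.
pose B := 1 + \sum_i (`|c i| + \sum_j `|A i j| * `|b|).
have Bi i : 0 <= `|c i| + \sum_j `|A i j| * `|b|.
  by rewrite addr_ge0 // sumr_ge0 // => j _; rewrite mulr_ge0.
have B0 : 0 < B by rewrite ltr_wpDr // sumr_ge0.
have affB s i : `|affsum A c phi s i| <= B.
  rewrite /B (bigD1 i) //= addrCA ler_wpDr ?addr_ge0 ?sumr_ge0 //.
  apply: le_trans (ler_normD _ _) _; rewrite lerD2l.
  apply: le_trans (ler_norm_sum _ _ _) _; apply: ler_sum => j _.
  by rewrite normrM ler_wpM2l // (le_trans (phib _ _)) // ler_norm.
pose K := [set s : 'rV[R]_n | forall i, `[(- (2 * B)), (2 * B)]%classic (s ord0 i)].
pose dist (s : 'rV[R]_n) := \sum_i `|s ord0 i - affsum A c phi (s ord0) i|.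
have [s0 s0K s0min] : exists2 s, s \in K & forall t, t \in K -> dist s <= dist t.
  apply: EVT_min_rV.
  - by exists 0 => i /=; rewrite mxE in_itv /= oppr_le0 andbb mulr_ge0 // ltW.
  - apply: (@rV_compact _ _ (fun=> `[(- (2 * B)), (2 * B)]%classic)) => _.
    exact: segment_compact.
  apply: continuous_subspaceT.
  apply: (@continuous_big R _ +%R) => [|i _]; first exact: add_continuous.
  have coord j : continuous (fun s : 'rV[R]_n => s ord0 j).
    exact: coord_continuous.
  have cont_aff : continuous (fun s : 'rV[R]_n => affsum A c phi (s ord0) i).
    have cont_sum : continuous
        (fun s : 'rV[R]_n => \sum_j A i j * phi j (s ord0 j)).
      apply: (@continuous_big R _ +%R) => [|j _]; first exact: add_continuous.
      have cont_phi : continuous (fun s : 'rV[R]_n => phi j (s ord0 j)).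
        by move=> s; apply: continuous_comp; [exact: coord|exact: cphi].
      by move=> s; exact: (cvgM (cvg_cst _) (cont_phi s)).
    by move=> s; exact: (cvgD (cvg_cst _) (cont_sum s)).
  by move=> s; exact: (cvg_norm (cvgB (coord i s) (cont_aff s))).
have dist0 : dist s0 = 0.
  apply/eqP; rewrite eq_le; apply/andP; split; last by rewrite sumr_ge0.
  apply/ler_addgt0Pl => e e0; rewrite addr0.
  have en : 0 < e / n.+1%:R by rewrite divr_gt0 // ltr0n.
  have [t tP] := approx_separable_fixpoint cphi B0 affB en.
  apply: le_trans (s0min (\row_i t i) _) _.
    rewrite inE => i /=; rewrite mxE in_itv /= -ler_norml.
    by have [] := tP i.
  apply: le_trans (_ : \sum_(i < n) e / n.+1%:R <= _).
    rewrite /dist; have -> : (\row_i t i) ord0 = t by apply/funext => i; rewrite mxE.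
    by apply: ler_sum => i _; have [_] := tP i.
  rewrite sumr_const card_ord -[leLHS]mulr_natr mulrAC ler_pdivrMr ?ltr0n //.
  by rewrite ler_wpM2l ?ltW // ltr_nat.
exists (s0 ord0) => i; apply/eqP; rewrite -subr_eq0 -normr_le0.
rewrite -dist0 /dist (bigD1 i) //= lerDl sumr_ge0 //.
Qed.

(** * The matrix exponential to second order *)

Lemma cvg_mx_entries (R : realType) m n (u : nat -> 'M[R]_(m, n)) (l : 'M[R]_(m, n)) :
  (forall i j, u k i j @[k --> \oo] --> l i j) -> u @ \oo --> l.
Proof.
move=> ul; apply/cvg_ballP => e e0.
have : \forall k \near \oo, forall i j, ball (l i j) e (u k i j).
  apply: filter_forall => i; apply: filter_forall => j.
  exact: (cvg_ball (ul i j)).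
by apply: filterS => k uk; split.
Qed.

Definition mx_bounded (R : realDomainType) m n (c : R) (A : 'M[R]_(m, n)) : Prop :=
  forall i j, `|A i j| <= c.

Lemma ex_mx_bound (R : realDomainType) m n (A : 'M[R]_(m, n)) :
  exists2 c, 0 <= c & mx_bounded c A.
Proof.
exists (\sum_i \sum_j `|A i j|) => [|i j].
  by rewrite sumr_ge0 // => i _; rewrite sumr_ge0.
rewrite (bigD1 i) //= (bigD1 j) //= -addrA lerDl addr_ge0 ?sumr_ge0 // => k _.
by rewrite sumr_ge0.
Qed.

Lemma mx_bounded_mul (R : realDomainType) m n p (a b : R)
    (A : 'M[R]_(m, n)) (B : 'M[R]_(n, p)) :
  mx_bounded a A -> mx_bounded b B -> mx_bounded (n%:R * a * b) (A *m B).
Proof.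
move=> Aa Bb i j; rewrite mxE; apply: le_trans (ler_norm_sum _ _ _) _.
apply: le_trans (_ : \sum_(k < n) a * b <= _).
  by apply: ler_sum => k _; rewrite normrM ler_pM.
by rewrite sumr_const card_ord -[leLHS]mulr_natl mulrA.
Qed.

Lemma mx_bounded_exp (R : realType) n (a : R) (A : 'M[R]_n) (k : nat) :
  0 <= a -> mx_bounded a A -> mx_bounded ((n%:R * a) ^+ k) (A ^+ k).
Proof.
move=> a0 Aa; elim: k => [|k IH] i j.
  by rewrite !expr0 mxE; case: (i == j); rewrite ?normr1 ?normr0.
by rewrite !exprS; apply: mx_bounded_mul.
Qed.

Lemma exprmxZ (R : comPzRingType) n (t : R) (A : 'M[R]_n) k :
  (t *: A) ^+ k = t ^+ k *: A ^+ k.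
Proof.
elim: k => [|k IH]; first by rewrite !expr0 scale1r.
rewrite !exprS IH -[LHS]/(_ *m _) -[A * _]/(_ *m _).
by rewrite -scalemxAl -scalemxAr scalerA.
Qed.

Lemma series_expR_le (R : realType) (c : R) N :
  0 <= c -> \sum_(0 <= k < N) exp_coeff c k <= expR c.
Proof.
move=> c0; apply: (@nondecreasing_cvgn_le R (series (exp_coeff c))).
  by apply/nondecreasing_seqP => k; rewrite /series /= big_nat_recr //= lerDl exp_coeff_ge0.
exact: is_cvg_series_exp_coeff.
Qed.

(** Entrywise, the terms of order at least 3 of the exponential series are
    bounded by t^3 times those of exp(c), where c = n max |A_ij|. *)
Lemma expmx_taylor2 (R : realType) n (A : 'M[R]_n) :
  exists2 C, 0 <= C & forall t, 0 <= t <= 1 -> mx_bounded (C * t ^+ 3)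
    (expmx (t *: A) - (1%:M + t *: A + (t ^+ 2 / 2) *: (A *m A))).
Proof.
have [a a0 Aa] := ex_mx_bound A; pose c := n%:R * a.
have c0 : 0 <= c by rewrite mulr_ge0.
exists (expR c) => [|t /andP[t0 t1] i j]; first exact: expR_ge0.
pose u i' j' k := (k`!%:R)^-1 * (t ^+ k * (A ^+ k) i' j').
have u_le i' j' m k : (m <= k)%N -> `|u i' j' k| <= t ^+ m * exp_coeff c k.
  move=> mk; rewrite /u !normrM normfV normr_nat mulrC /exp_coeff /= mulrA.
  rewrite ler_wpM2r ?invr_ge0 // normrX ger0_norm // ler_pM ?exprn_ge0 //.
    by rewrite ler_wiXn2l.
  exact: mx_bounded_exp.
have u_cvg i' j' : cvgn (series (u i' j')).
  apply: normed_cvg; apply: series_le_cvg (is_cvg_series_exp_coeff c) => k //=.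
    by rewrite exp_coeff_ge0.
  by have := @u_le i' j' 0%N k (leq0n k); rewrite expr0 mul1r.
have entry i' j' k : series (fun k => (k`!%:R)^-1 *: ((t *: A) ^+ k)) k i' j' =
    series (u i' j') k.
  rewrite /series /= summxE; apply: eq_bigr => m _.
  by rewrite exprmxZ !mxE.
have expE : expmx (t *: A) i j = limn (series (u i j)).
  rewrite /expmx (@cvg_lim _ _ _ _ _ _ (\matrix_(i', j')
    limn (series (u i' j')))) //.
    by rewrite mxE.
  apply: cvg_mx_entries => i' j'; rewrite mxE.
  by under eq_cvg do rewrite entry; exact: u_cvg.
have u3 : series (u i j) 3%N = (1%:M + t *: A + (t ^+ 2 / 2) *: (A *m A)) i j.
  rewrite /series /= big_nat_recr //= big_nat_recr //= big_nat1 /u.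
  rewrite (_ : A ^+ 0 = 1%:M) // (_ : A ^+ 1 = A) // (_ : A ^+ 2 = A *m A) //.
  rewrite [RHS]mxE [X in _ = X + _]mxE [(t *: A) i j]mxE [(_ *: (A *m A)) i j]mxE.
  move: (1%:M i j) ((A *m A) i j) => x y.
  by rewrite (_ : 0`! = 1%N) // (_ : 1`! = 1%N) // (_ : 2`! = 2%N) //; field.
have cu : series (u i j) N - series (u i j) 3%N @[N --> \oo] -->
    limn (series (u i j)) - series (u i j) 3%N.
  by apply: cvgB; [exact: u_cvg|exact: cvg_cst].
rewrite mxE [in X in _ + X]mxE -u3 expE.
apply: (cvgr_to_le (cvg_norm cu)).
near=> N; have N3 : (3 <= N)%N by near: N; exact: nbhs_infty_ge.
rewrite /series /= (big_cat_nat (n := 3%N)) //= addrAC subrr add0r.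
apply: le_trans (ler_norm_sum _ _ _) _; rewrite mulrC.
apply: le_trans (_ : \sum_(3 <= k < N) t ^+ 3 * exp_coeff c k <= _).
  by apply: ler_sum_nat => k /andP[k3 _]; exact: u_le.
rewrite -mulr_sumr ler_wpM2l ?exprn_ge0 //.
apply: le_trans (series_expR_le N c0).
rewrite [leRHS](big_cat_nat (n := 3%N)) //= lerDr sumr_ge0 // => k _.
exact: exp_coeff_ge0.
Unshelve. all: by end_near.
Qed.

Lemma mx_boundedD (R : realDomainType) m n (a b : R) (A B : 'M[R]_(m, n)) :
  mx_bounded a A -> mx_bounded b B -> mx_bounded (a + b) (A + B).
Proof.
by move=> Aa Bb i j; rewrite mxE (le_trans (ler_normD _ _)) // lerD.
Qed.

Lemma mx_boundedZ (R : realDomainType) m n (a t : R) (A : 'M[R]_(m, n)) :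
  mx_bounded a A -> mx_bounded (`|t| * a) (t *: A).
Proof. by move=> Aa i j; rewrite mxE normrM ler_wpM2l. Qed.

Lemma mx_bounded_le (R : realDomainType) m n (a b : R) (A : 'M[R]_(m, n)) :
  a <= b -> mx_bounded a A -> mx_bounded b A.
Proof. by move=> ab Aa i j; apply: le_trans (Aa i j) ab. Qed.

(** X(t) = I + t A1 + t^2 A2 + O(t^3) on [0, 1]. *)
Definition taylor2 (R : realType) n (X : R -> 'M[R]_n) (A1 A2 : 'M[R]_n) : Prop :=
  exists2 C, 0 <= C & forall t, 0 <= t <= 1 ->
    mx_bounded (C * t ^+ 3) (X t - (1%:M + t *: A1 + t ^+ 2 *: A2)).

Lemma taylor2_poly_bounded (R : realType) n (A1 A2 : 'M[R]_n) :
  exists2 b, 0 <= b & forall t, 0 <= t <= 1 ->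
    mx_bounded b (1%:M + t *: A1 + t ^+ 2 *: A2).
Proof.
have [a1 a1_0 A1b] := ex_mx_bound A1; have [a2 a2_0 A2b] := ex_mx_bound A2.
have [a0 a0_0 A0b] := ex_mx_bound (1%:M : 'M[R]_n).
exists (a0 + a1 + a2) => [|t /andP[t0 t1]]; first by rewrite !addr_ge0.
have scale s a (A : 'M[R]_n) : 0 <= s <= 1 -> 0 <= a -> mx_bounded a A -> mx_bounded a (s *: A).
  move=> /andP[s0 s1] a_0 Ab; apply: mx_bounded_le (mx_boundedZ s Ab).
  by rewrite ger0_norm // ler_piMl.
apply: mx_boundedD; first apply: mx_boundedD => //.
  by apply: scale => //; rewrite t0.
by apply: scale => //; rewrite exprn_ge0 //= exprn_ile1.
Qed.

Lemma taylor2_mul (R : realType) n (X Y : R -> 'M[R]_n) (A1 A2 B1 B2 : 'M[R]_n) :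
  taylor2 X A1 A2 -> taylor2 Y B1 B2 ->
  taylor2 (fun t => X t *m Y t) (A1 + B1) (A2 + A1 *m B1 + B2).
Proof.
move=> [C C0 XC] [D D0 YD].
have [a a0 Pa] := taylor2_poly_bounded A1 A2.
have [b b0 Qb] := taylor2_poly_bounded B1 B2.
have [c' c'0 Rc'] := ex_mx_bound (A1 *m B2 + A2 *m B1).
have [c2 c20 Rc2] := ex_mx_bound (A2 *m B2).
exists (n%:R * C * (D + b) + n%:R * a * D + (c' + c2)).
  by rewrite !addr_ge0 ?mulr_ge0 ?addr_ge0.
move=> t t01; have /andP[t0 t1] := t01.
set P := 1%:M + t *: A1 + t ^+ 2 *: A2; set Q := 1%:M + t *: B1 + t ^+ 2 *: B2.
have -> : X t *m Y t -
    (1%:M + t *: (A1 + B1) + t ^+ 2 *: (A2 + A1 *m B1 + B2)) =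
    (X t - P) *m Y t + P *m (Y t - Q) +
    t ^+ 3 *: (A1 *m B2 + A2 *m B1 + t *: (A2 *m B2)).
  have -> : 1%:M + t *: (A1 + B1) + t ^+ 2 *: (A2 + A1 *m B1 + B2) =
      P *m Q - t ^+ 3 *: (A1 *m B2 + A2 *m B1 + t *: (A2 *m B2)).
    rewrite /P /Q !mulmxDl !mulmxDr !mul1mx !mulmx1 -!scalemxAl -!scalemxAr.
    move: (A1 *m B1) (A1 *m B2) (A2 *m B1) (A2 *m B2) => m11 m12 m21 m22.
    by apply/matrixP => i j; rewrite !mxE; ring.
  rewrite mulmxBl mulmxBr; move: (X t *m Y t) (P *m Y t) (P *m Q) => u v w.
  by apply/matrixP => i j; rewrite !mxE; ring.
have t3 : 0 <= t ^+ 3 <= 1 by rewrite exprn_ge0 //= exprn_ile1.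
have Yb : mx_bounded (D + b) (Y t).
  rewrite -[Y t](subrK Q); apply: mx_boundedD; last exact: Qb.
  apply: mx_bounded_le (YD _ t01); rewrite ler_piMr //; lra.
have b1 := mx_bounded_mul (XC _ t01) Yb.
have b2 := mx_bounded_mul (Pa _ t01) (YD _ t01).
have b3 : mx_bounded (t ^+ 3 * (c' + c2))
    (t ^+ 3 *: (A1 *m B2 + A2 *m B1 + t *: (A2 *m B2))).
  rewrite -{1}[t ^+ 3]ger0_norm; last by case/andP: t3.
  apply: mx_boundedZ; apply: mx_boundedD => //.
  apply: mx_bounded_le (mx_boundedZ t Rc2); rewrite ger0_norm // ler_piMl //.
apply: mx_bounded_le (mx_boundedD (mx_boundedD b1 b2) b3).
by rewrite le_eqVlt; apply/orP; left; apply/eqP; ring.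
Qed.

Lemma taylor2_expmx (R : realType) n (A : 'M[R]_n) :
  taylor2 (fun t => expmx (t *: A)) A (2^-1 *: (A *m A)).
Proof.
have [C C0 AC] := expmx_taylor2 A; exists C => // t t01.
by rewrite scalerA; exact: AC.
Qed.

(** The splitting is symmetric, so that Phi agrees with exp(t (Mx + My)) to
    second order even if Mx and My do not commute. *)
Lemma taylor2_Phimx (R : realType) n (Mx My : 'M[R]_n) :
  taylor2 (Phimx Mx My) (Mx + My) (2^-1 *: ((Mx + My) *m (Mx + My))).
Proof.
pose H := 2^-1 *: Mx.
have tE := taylor2_mul (taylor2_mul (taylor2_expmx H) (taylor2_expmx My)) (taylor2_expmx H).
have [C C0 PC] := tE; exists C => // t /PC.
rewrite /Phimx (_ : t *: H = (t / 2) *: Mx); last by rewrite scalerA.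
have -> : H + My + H = Mx + My.
  by rewrite addrAC -scalerDl (_ : 2^-1 + 2^-1 = 1) ?scale1r //; field.
rewrite (_ : _ + _ *m _ + _ *: (H *m H) = 2^-1 *: ((Mx + My) *m (Mx + My))) //.
rewrite /H !mulmxDl !mulmxDr -!scalemxAl -!scalemxAr.
move: (Mx *m Mx) (Mx *m My) (My *m Mx) (My *m My) => a b c d.
by apply/matrixP => i j; rewrite !mxE; field.
Qed.

(** The second order term is kept because the propagator multiplies a reaction
    that may be of order 1/t: a contribution of order t then remains, whose sign
    is controlled through the entries of Mx + My. *)
Lemma propagator_expansion (R : realType) n (Mx My : 'M[R]_n) :
  Mx + My \in unitmx ->
  exists2 C, 0 <= C & forall t, 0 <= t <= 1 ->
    mx_bounded (C * t ^+ 3) (invmx (Mx + My) *m (Phimx Mx My t - 1%:M)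
      - (t%:M + (t ^+ 2 / 2) *: (Mx + My))).
Proof.
move=> Munit; have [C C0 PC] := taylor2_Phimx Mx My.
have [a a0 Ma] := ex_mx_bound (invmx (Mx + My)).
exists (n%:R * a * C) => [|t t01]; first by rewrite !mulr_ge0.
rewrite -mulrA; have := mx_bounded_mul Ma (PC t t01).
congr (mx_bounded _ _); rewrite -addrA opprD addrA mulmxBr; congr (_ - _).
rewrite mulmxDr -!scalemxAr mulmxA mulVmx // mul1mx scalemx1.
by rewrite scalerA.
Qed.

(** * The discrete diffusion operator *)

Definition offdiag_ge0 (R : numDomainType) n (A : 'M[R]_n) : Prop :=
  forall i j, i != j -> 0 <= A i j.

(** At an index where |v_i| / phi_i is maximal, the equation A v = 0 contradicts
    A phi < 0: this is the maximum principle for v relative to phi. *)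
Lemma supersolution_unitmx (R : realFieldType) n (A : 'M[R]_n) (phi : 'I_n -> R) :
  offdiag_ge0 A -> (forall i, 0 < phi i) -> (forall i, \sum_j A i j * phi j < 0) ->
  A \in unitmx.
Proof.
move=> offA phi0 Aphi; rewrite -unitmx_tr unitmxE unitfE; apply/det0P => -[v v0 vA].
have Av i : \sum_j A i j * v 0 j = 0.
  have /matrixP/(_ 0 i) := vA; rewrite !mxE => {2}<-.
  by apply: eq_bigr => j _; rewrite mxE mulrC.
have [i0 vi0] : exists i, v 0 i != 0.
  by apply/rV0Pn.
pose i := [arg max_(i > i0) (`|v 0 i| / phi i)]%O.
have iP j : `|v 0 j| / phi j <= `|v 0 i| / phi i.
  by rewrite /i; case: arg_maxP => //= k _ /(_ j isT).
set r := `|v 0 i| / phi i in iP.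
have r0 : 0 < r by apply: lt_le_trans (iP i0); rewrite divr_gt0 // normr_gt0.
have vi : `|v 0 i| = r * phi i by rewrite /r divfK // gt_eqF.
have := Aphi i; have := Av i; rewrite (bigD1 i) //= [in X in _ -> X](bigD1 i) //=.
set S := \sum_(j | j != i) A i j * v 0 j; set S' := \sum_(j | j != i) A i j * phi j.
have SS' : `|S| <= r * S'.
  apply: le_trans (ler_norm_sum _ _ _) _; rewrite mulr_sumr ler_sum // => j ji.
  rewrite normrM (ger0_norm (offA _ _ _)) 1?eq_sym // mulrCA ler_wpM2l //.
    by apply: offA; rewrite eq_sym.
  by rewrite -ler_pdivrMr.
have S'0 : 0 <= S'.
  by apply: sumr_ge0 => j ji; rewrite mulr_ge0 ?(ltW (phi0 j)) // offA // eq_sym.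
move=> /eqP; rewrite addr_eq0 => /eqP vS diag.
have : `|A i i * v 0 i| = `|S| by rewrite vS normrN.
have Aii : A i i < 0.
  by rewrite -(pmulr_llt0 _ (phi0 i)); lra.
rewrite normrM vi (ltr0_norm Aii) => eqS.
have : r * (A i i * phi i + S') < 0 by rewrite pmulr_rlt0.
by move: eqS SS'; rewrite mulrDr; lra.
Qed.

Lemma sum_ord_pick (R : nmodType) N (k : nat) (F : nat -> R) :
  \sum_(j < N) (if j == k :> nat then F j else 0) = if (k < N)%N then F k else 0.
Proof.
case: ltnP => kN.
  rewrite (bigD1 (Ordinal kN)) //= eqxx big1 ?addr0 // => j /eqP jk.
  by case: eqP => // jk'; case: jk; apply: val_inj.
by rewrite big1 // => j _; case: eqP => // jk; move: (ltn_ord j); rewrite jk ltnNge kN.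
Qed.

Lemma spacing_gt0 (R : realType) N (x : nat -> R) i :
  mesh N x -> (i <= N)%N -> 0 < spacing x i.
Proof. by case=> _ _ xlt iN; rewrite subr_gt0 xlt. Qed.

Lemma Tmx_offdiag_ge0 (R : realType) N (x : nat -> R) :
  mesh N x -> offdiag_ge0 (Tmx N x).
Proof.
move=> mx i j ij; rewrite mxE /= eq_sym (negPf ij).
have h k : (k <= N)%N -> 0 <= spacing x k by move=> kN; exact/ltW/(spacing_gt0 mx).
have coef (a b c : R) : 0 <= a -> 0 <= b -> 0 <= c -> 0 <= 2 / (a * (b + c)).
  by move=> a0 b0 c0; rewrite divr_ge0 // mulr_ge0 // addr_ge0.
have := ltn_ord i; have := ltn_ord j => jN iN.
case: eqP => [ji|_].
  by apply: coef; apply: h; lia.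
case: eqP => [ij'|_] //.
by apply: coef; apply: h; lia.
Qed.

(** A grid function that vanishes at both end points undergoes the full three
    point second difference at every interior node, also next to the boundary,
    where the row of the matrix lacks an entry. *)
Lemma Tmx_sum (R : realType) N (x u : nat -> R) (i : 'I_N) :
  u 0%N = 0 -> u N.+1 = 0 ->
  let h := spacing x in
  \sum_j Tmx N x i j * u j.+1 =
    - (2 / (h i * h i.+1)) * u i.+1 + 2 / (h i.+1 * (h i + h i.+1)) * u i.+2 +
    2 / (h i * (h i + h i.+1)) * u i.
Proof.
move=> u0 uN h.
pose F1 j := - (2 / (h i * h i.+1)) * u j.+1.
pose F2 j := 2 / (h i.+1 * (h i + h i.+1)) * u j.+1.
pose F3 (j : nat) := 2 / (h j.+1 * (h j.+1 + h j.+2)) * u j.+1.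
transitivity (\sum_(j < N) ((if j == i :> nat then F1 j else 0) +
    (if j == i.+1 :> nat then F2 j else 0) + (if i == j.+1 :> nat then F3 j else 0))).
  apply: eq_bigr => j _; rewrite mxE -/h /F1 /F2 /F3.
  have -> : (j == i) = (j == i :> nat) by [].
  case: (eqVneq (j : nat) i) => [ji|ji].
    by rewrite ji ltn_eqF // !addr0.
  rewrite add0r; case: (eqVneq (j : nat) i.+1) => [ji'|ji'].
    by rewrite ji' ltn_eqF // addr0.
  by rewrite add0r; case: ifP; rewrite ?mul0r.
rewrite !big_split /= !sum_ord_pick ltn_ord; congr (_ + _ + _).
  case: ltnP => // iN; have -> : i.+2 = N.+1 by have := ltn_ord i; lia.
  by rewrite uN mulr0.
case: i @F1 @F2 => -[|i] iN F1 F2 /=.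
  by rewrite u0 mulr0 big1.
under eq_bigr => j _ do rewrite eqSS eq_sym.
by rewrite sum_ord_pick ltnW.
Qed.

(** The three point formula is exact for quadratic functions, and 1 - x^2
    vanishes at both end points. *)
Lemma Tmx_quadratic (R : realType) N (x : nat -> R) (i : 'I_N) :
  mesh N x -> \sum_j Tmx N x i j * (1 - x j.+1 ^+ 2) = - 2.
Proof.
move=> mx; have [x0 xN _] := mx.
have hi : 0 < spacing x i by apply: spacing_gt0 mx _; exact: ltnW.
have hi1 : 0 < spacing x i.+1 by exact: spacing_gt0 mx _.
rewrite (@Tmx_sum R N x (fun k => 1 - x k ^+ 2)) ?x0 ?xN ?sqrrN ?expr1n ?subrr //.
have -> : x i.+2 = x i + spacing x i + spacing x i.+1 by rewrite /spacing; ring.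
have -> : x i.+1 = x i + spacing x i by rewrite /spacing; ring.
move: (spacing x i) (spacing x i.+1) hi hi1 => h h' h0 h'0.
by field; rewrite !gt_eqF //= addr_gt0.
Qed.

Lemma Tmx_rowsum_le0 (R : realType) N (x : nat -> R) (i : 'I_N) :
  mesh N x -> \sum_j Tmx N x i j <= 0.
Proof.
move=> mx.
have hi : 0 < spacing x i by apply: spacing_gt0 mx _; exact: ltnW.
have hi1 : 0 < spacing x i.+1 by exact: spacing_gt0 mx _.
(* the constant 1 inside, extended by the boundary value 0 *)
pose u k : R := if (0 < k <= N)%N then 1 else 0.
have u01 k : 0 <= u k <= 1 by rewrite /u; case: ifP; rewrite ?lexx ler01.
under eq_bigr => j _.
  rewrite -[Tmx _ _ _ _]mulr1 (_ : 1 = u j.+1); last by rewrite /u ltn_ord.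
  over.
have u_i : u i.+1 = 1 by rewrite /u ltn_ord.
have u_N : u N.+1 = 0 by rewrite /u ltnn andbF.
rewrite (@Tmx_sum R N x u i) // u_i mulr1.
have := u01 i; have := u01 i.+2; move: (u i) (u i.+2) => p q q01 p01.
move: (spacing x i) (spacing x i.+1) hi hi1 => h h' h0 h'0.
have c1 : 0 <= 2 / (h' * (h + h')) by rewrite divr_ge0 // mulr_ge0 ?addr_ge0 // ltW.
have c2 : 0 <= 2 / (h * (h + h')) by rewrite divr_ge0 // mulr_ge0 ?addr_ge0 // ltW.
have -> : - (2 / (h * h')) = - (2 / (h' * (h + h'))) - 2 / (h * (h + h')).
  by field; rewrite !gt_eqF //= addr_gt0.
nra.
Qed.

Lemma mesh_lt (R : realType) N (x : nat -> R) i j :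
  mesh N x -> (i < j <= N.+1)%N -> x i < x j.
Proof.
case=> _ _ xlt; elim: j => [|j IH] //; rewrite ltnS => /andP[ij jN].
have xj := xlt j jN; case: (ltngtP i j) ij => // [ij _|-> //].
by apply: lt_trans xj; apply: IH; rewrite ij ltnW.
Qed.

Lemma mesh_interior (R : realType) N (x : nat -> R) (i : 'I_N) :
  mesh N x -> -1 < x i.+1 < 1.
Proof.
move=> mx; have [x0 xN _] := mx.
rewrite -{1}x0 -xN !(mesh_lt mx) //; first by have := ltn_ord i; lia.
by have := ltn_ord i; lia.
Qed.

Lemma sigma_interior_gt0 (R : realType) (Nx Ny : nat) (x y : nat -> R)
    (sigma : R -> R -> R) (k : 'I_(Ny * Nx)) :
  mesh Nx x -> mesh Ny y -> degeneracy sigma ->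
  0 < sigma (grid_x x k) (grid_y y k).
Proof.
move=> mx my deg.
have /andP[xl xr] := mesh_interior (mxtens_unindex k).2 mx.
have /andP[yl yr] := mesh_interior (mxtens_unindex k).1 my.
have [||s0 sne] := deg (grid_x x k) (grid_y y k).
- by rewrite !ltW.
- by rewrite !ltW.
rewrite lt_neqAle s0 andbT; apply/negP => /eqP/esym/sne.
rewrite /grid_x /grid_y; have nx (z : R) : -1 < z -> z < 1 -> `|z| <> 1.
  by move=> z1 z2 /eqP; rewrite lt_eqF // ltr_norml z1.
by case; exact: nx.
Qed.

Lemma Mxmx_entry (R : realType) (Nx Ny : nat) (x y : nat -> R)
    (sigma : R -> R -> R) (a : R) (k l : 'I_(Ny * Nx)) :
  Mxmx Nx Ny x y sigma a k l =
  a ^- 2 * (sigma (grid_x x k) (grid_y y k))^-1 *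
  ((1%:M : 'M[R]_Ny) (mxtens_unindex k).1 (mxtens_unindex l).1 *
   Tmx Nx x (mxtens_unindex k).2 (mxtens_unindex l).2).
Proof.
by rewrite mxE mul_diag_mx !mxE mulrA.
Qed.

Lemma Mymx_entry (R : realType) (Nx Ny : nat) (x y : nat -> R)
    (sigma : R -> R -> R) (b : R) (k l : 'I_(Ny * Nx)) :
  Mymx Nx Ny x y sigma b k l =
  b ^- 2 * (sigma (grid_x x k) (grid_y y k))^-1 *
  (Tmx Ny y (mxtens_unindex k).1 (mxtens_unindex l).1 *
   (1%:M : 'M[R]_Nx) (mxtens_unindex k).2 (mxtens_unindex l).2).
Proof. by rewrite mxE mul_diag_mx !mxE mulrA. Qed.

Lemma M_offdiag_ge0 (R : realType) (Nx Ny : nat) (x y : nat -> R)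
    (sigma : R -> R -> R) (a b : R) :
  mesh Nx x -> mesh Ny y -> degeneracy sigma ->
  offdiag_ge0 (Mxmx Nx Ny x y sigma a + Mymx Nx Ny x y sigma b).
Proof.
move=> mx my deg k l kl; rewrite mxE Mxmx_entry Mymx_entry.
have s0 := sigma_interior_gt0 k mx my deg.
have coef (c : R) : 0 <= c ^- 2 * (sigma (grid_x x k) (grid_y y k))^-1.
  by rewrite mulr_ge0 // invr_ge0 ?sqr_ge0 ?ltW.
rewrite ![1%:M _ _]mxE; have [k1l1|k1l1] := eqVneq (mxtens_unindex k).1 (mxtens_unindex l).1;
  have [k2l2|k2l2] := eqVneq (mxtens_unindex k).2 (mxtens_unindex l).2.
- case/eqP: kl; rewrite -(mxtens_unindexK k) -(mxtens_unindexK l).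
  by congr mxtens_index; apply/eqP; rewrite xpair_eqE; apply/andP; split; apply/eqP.
- rewrite mulr0 mulr0 addr0 mul1r mulr_ge0 ?coef //.
  exact: Tmx_offdiag_ge0.
- rewrite mul0r mulr0 add0r mulr1 mulr_ge0 ?coef //.
  exact: Tmx_offdiag_ge0.
- by rewrite mul0r !mulr0 addr0.
Qed.

(** The function 1 - x^2, constant in y, is a strict supersolution: the x part
    contributes - 2 / (a^2 sigma) and the y part, having nonpositive row sums,
    contributes nothing positive. *)
Lemma M_unitmx (R : realType) (Nx Ny : nat) (x y : nat -> R)
    (sigma : R -> R -> R) (a b : R) :
  0 < a -> mesh Nx x -> mesh Ny y -> degeneracy sigma ->
  Mxmx Nx Ny x y sigma a + Mymx Nx Ny x y sigma b \in unitmx.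
Proof.
move=> a0 mx my deg.
pose phi (k : 'I_(Ny * Nx)) := 1 - x (mxtens_unindex k).2.+1 ^+ 2.
have phi0 k : 0 < phi k.
  have /andP[] := mesh_interior (mxtens_unindex k).2 mx; rewrite /phi; nra.
apply: (supersolution_unitmx (phi := phi)) => //; first exact: M_offdiag_ge0.
move=> k; have s0 := sigma_interior_gt0 k mx my deg.
set s := sigma _ _ in s0.
have -> : \sum_l (Mxmx Nx Ny x y sigma a + Mymx Nx Ny x y sigma b) k l * phi l =
    a ^- 2 * s^-1 * - 2 +
    b ^- 2 * s^-1 * ((\sum_j Tmx Ny y (mxtens_unindex k).1 j) * phi k).
  pose one1 (j : 'I_Ny) := (1%:M : 'M[R]_Ny) (mxtens_unindex k).1 j.
  pose one2 (i : 'I_Nx) := (1%:M : 'M[R]_Nx) (mxtens_unindex k).2 i * (1 - x i.+1 ^+ 2).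
  have sum1 : \sum_j one1 j = 1.
    rewrite (bigD1 (mxtens_unindex k).1) //= /one1 mxE eqxx big1 ?addr0 // => j jk.
    by rewrite mxE eq_sym (negPf jk).
  have sum2 : \sum_i one2 i = phi k.
    rewrite (bigD1 (mxtens_unindex k).2) //= /one2 mxE eqxx mul1r big1 ?addr0 // => j jk.
    by rewrite mxE eq_sym (negPf jk) mul0r.
  pose Tq (i : 'I_Nx) := Tmx Nx x (mxtens_unindex k).2 i * (1 - x i.+1 ^+ 2).
  rewrite -[- 2]mul1r -{1}sum1 -(Tmx_quadratic (mxtens_unindex k).2 mx) -sum2.
  rewrite (mulr_sum one1 Tq) mulr_sum !mulr_sumr -big_split /=.
  apply: eq_bigr => l _; rewrite mxE Mxmx_entry Mymx_entry -/s mulrDl.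
  by rewrite /one1 /one2 /Tq /phi; congr (_ + _); ring.
have c1 : 0 < a ^- 2 * s^-1 by rewrite mulr_gt0 // invr_gt0 // exprn_gt0.
have c2 : 0 <= b ^- 2 * s^-1 by rewrite mulr_ge0 // invr_ge0 ?sqr_ge0 ?ltW.
have := Tmx_rowsum_le0 (mxtens_unindex k).1 my.
set T := \sum_j _ => T0.
have : T * phi k <= 0 by rewrite pmulr_lle0.
by move=> Tp; nra.
Qed.

(** * Monotonicity and continuity of the reaction *)

Lemma is_derive01_slope (R : realType) (F : R -> R) (u l e : R) :
  is_derive01 F u l -> 0 < e ->
  exists2 d, 0 < d & forall s, 0 <= s < 1 -> s != u -> `|s - u| < d ->
    `|l - (s - u)^-1 * (F s - F u)| < e.
Proof.
move=> /cvgrPdist_lt Fl e0; have := Fl _ e0 => /nbhs_ballP[d /= d0 dP].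
exists d => // s s01 su sd.
have us : u + (s - u) = s by ring.
have := dP (s - u); rewrite /ball /= sub0r normrN us; apply => //.
by rewrite subr_eq0.
Qed.

Lemma is_derive01_continuous (R : realType) (F : R -> R) (u l e : R) :
  is_derive01 F u l -> 0 < e ->
  exists2 d, 0 < d & forall s, 0 <= s < 1 -> `|s - u| < d -> `|F s - F u| < e.
Proof.
move=> Fl e0; have [d d0 dP] := is_derive01_slope Fl ltr01.
exists (Num.min d (e / (`|l| + 1))) => [|s s01].
  by rewrite lt_min d0 divr_gt0 // ltr_wpDl.
rewrite lt_min => /andP[sd]; rewrite ltr_pdivlMr ?ltr_wpDl // => se.
have [->|su] := eqVneq s u; first by rewrite subrr normr0.
apply: le_lt_trans se; have su0 : s - u != 0 by rewrite subr_eq0.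
have q_le := dP s s01 su sd.
rewrite -[F s - F u](mulVKf su0) normrM ler_wpM2l //.
have := ler_normB l (l - (s - u)^-1 * (F s - F u)).
by rewrite opprB addrC subrK; lra.
Qed.

(** A positive derivative, without any continuity of it, makes F increase in a
    neighbourhood of each point.  If F b < F a then the supremum of the points
    of [a, b] where F is at least F a cannot have this property. *)
Lemma is_derive01_nondecreasing (R : realType) (F : R -> R) :
  (forall u, 0 <= u < 1 -> exists l, is_derive01 F u l /\ 0 < l) ->
  forall s t, 0 <= s -> s <= t -> t < 1 -> F s <= F t.
Proof.
move=> dF a b a0 ab b1; rewrite leNgt; apply/negP => Fba.
have local u : 0 <= u < 1 -> exists2 d, 0 < d &
    forall s, 0 <= s < 1 -> s != u -> `|s - u| < d -> 0 < (s - u)^-1 * (F s - F u).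
  move=> /dF[l [Fl l0]]; have [d d0 dP] := is_derive01_slope Fl l0.
  exists d => // s s01 su sd; have := dP s s01 su sd.
  by rewrite ltr_norml => /andP[]; lra.
pose S := [set s | a <= s <= b /\ F a <= F s].
have Sa : S a by split; rewrite ?lexx ?ab.
have supS : has_sup S by split; [exists a|exists b => s [/andP[]]].
set c := sup S.
have ac : a <= c by exact: ub_le_sup supS.2 _ Sa.
have cb : c <= b by apply: ge_sup => [|s [/andP[]]]; first by exists a.
have c01 : 0 <= c < 1 by rewrite (le_trans a0) //= (le_lt_trans cb).
have [d d0 dP] := local c c01.
have Fc : F a <= F c.
  have [s [/andP[s1 s2] Fs] cs] := sup_adherent d0 supS.
  have sc : s <= c by apply: ub_le_sup supS.2 _ _; split; rewrite ?s1.
  have [sc'|sc'] := eqVneq s c; first by rewrite -sc'.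
  apply: le_trans Fs _; rewrite -/c in cs.
  have sc0 : s - c < 0 by rewrite subr_lt0 lt_neqAle sc' sc.
  have := dP s; rewrite (le_trans a0) //= (le_lt_trans s2) // ltr0_norm //.
  rewrite nmulr_rgt0 ?invr_lt0 // => /(_ isT sc').
  by rewrite subr_lt0 => H; apply/ltW/H; lra.
have cb' : c < b.
  by rewrite lt_neqAle cb andbT; apply/eqP => cbE; move: Fc; rewrite cbE leNgt Fba.
pose s := c + Num.min (d / 2) (b - c).
have m0 : 0 < Num.min (d / 2) (b - c) by rewrite lt_min divr_gt0 //= subr_gt0.
have m1 : Num.min (d / 2) (b - c) <= d / 2 by rewrite ge_min lexx.
have m2 : Num.min (d / 2) (b - c) <= b - c by rewrite ge_min lexx orbT.
have cs : c < s by rewrite ltrDl.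
have sb : s <= b by rewrite /s; lra.
have := dP s; rewrite (le_trans a0 (le_trans ac (ltW cs))) (le_lt_trans sb) //=.
rewrite (gt_eqF cs) => /(_ isT isT).
rewrite gtr0_norm ?subr_gt0 // pmulr_rgt0 ?invr_gt0 ?subr_gt0 // => Fsc.
have : s <= c.
  apply: ub_le_sup supS.2 _ _; split; first by rewrite sb (le_trans ac (ltW cs)).
  by apply: le_trans Fc (ltW (Fsc _)); rewrite /s; lra.
by rewrite leNgt cs.
Qed.

(** * One step of the scheme *)

Lemma ex_rowsum_bound (R : realDomainType) n (M : 'M[R]_n) :
  exists2 m, 0 <= m & forall i, \sum_j `|M i j| <= m.
Proof.
exists (\sum_i \sum_j `|M i j|) => [|i].
  by rewrite sumr_ge0 // => i _; rewrite sumr_ge0.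
rewrite [leRHS](bigD1 i) //= lerDl sumr_ge0 // => k _.
by rewrite sumr_ge0.
Qed.

Lemma rowsum_mulmx (R : realDomainType) n (M : 'M[R]_n) (m c : R) (u : 'cV[R]_n) :
  (forall i, \sum_j `|M i j| <= m) -> 0 <= c -> mx_bounded c u ->
  mx_bounded (m * c) (M *m u).
Proof.
move=> Mm c0 uc i j; rewrite mxE; apply: le_trans (ler_norm_sum _ _ _) _.
apply: le_trans (_ : (\sum_k `|M i k|) * c <= _); last by rewrite ler_wpM2r.
by rewrite mulr_suml ler_sum // => k _; rewrite normrM ler_wpM2l.
Qed.

Lemma ex_pos_lower_bound (R : realDomainType) n (F : 'I_n -> R) :
  (forall i, 0 < F i) -> exists2 e, 0 < e & forall i, e <= F i.
Proof.
move=> F0; exists (\big[Num.min/1]_i F i) => [|i]; last exact: bigmin_le_cond.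
by apply/bigmin_gtP; split=> [|i _]; [exact: ltr01|exact: F0].
Qed.

(** Turns each smallness requirement on the time step into a bound for it. *)
Lemma ex_small (R : realFieldType) (a b : R) :
  0 < b -> exists2 d, 0 < d & forall t, 0 <= t <= d -> a * t <= b.
Proof.
move=> b0; have a1 : 0 < `|a| + 1 by rewrite ltr_wpDl.
exists (b / (`|a| + 1)) => [|t /andP[t0]]; first by rewrite divr_gt0.
rewrite ler_pdivlMr // => tb; apply: le_trans tb.
by rewrite mulrC ler_wpM2l // (le_trans (ler_norm a)) // lerDl.
Qed.

Lemma step_remainder (R : realFieldType) n (K Phi M : 'M[R]_n)
    (v q : 'cV[R]_n) (t : R) :
  Phi *m v + K *m (q - M *m v) - v - (t *: q + (t ^+ 2 / 2) *: (M *m q)) =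
  (K - (t%:M + (t ^+ 2 / 2) *: M)) *m q +
  (Phi - (1%:M + t *: M + t ^+ 2 *: (2^-1 *: (M *m M)))) *m v -
  (K - (t%:M + (t ^+ 2 / 2) *: M)) *m (M *m v).
Proof.
rewrite !mulmxBl !mulmxDl !mulmxBr -!scalemxAl !mul1mx !mul_scalar_mx -!mulmxA.
move: (K *m q) (K *m (M *m v)) (Phi *m v) (M *m q) (M *m (M *m v)) (M *m v).
by move=> x1 x2 x3 x4 x5 x6; apply/matrixP => i j; rewrite !mxE; field.
Qed.

(** The vector h stands for the weighted reaction.  Since Phi and M
    need not commute, the increment differs from M^-1 (Phi - I) q, but only by a
    term of third order in t that depends on v and not on h. *)
Lemma step_expansion (R : realType) n (Mx My : 'M[R]_n) :
  Mx + My \in unitmx ->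
  exists2 C, 0 <= C & forall t, 0 <= t <= 1 -> forall (v h : 'cV[R]_n) (N : R),
    mx_bounded 1 v -> let q := (Mx + My) *m v + h in mx_bounded N q ->
    mx_bounded (C * t ^+ 3 * (1 + N))
      (Phimx Mx My t *m v + invmx (Mx + My) *m (Phimx Mx My t - 1%:M) *m h - v
       - (t *: q + (t ^+ 2 / 2) *: ((Mx + My) *m q))).
Proof.
move=> Munit; have [C1 C10 KC] := propagator_expansion Munit.
have [C2 C20 PC] := taylor2_Phimx Mx My.
set M := Mx + My in Munit KC PC *.
have [a a0 Ma] := ex_mx_bound M.
exists (n%:R * C1 + n%:R * C2 + n%:R * C1 * (n%:R * a)).
  by rewrite !addr_ge0 ?mulr_ge0.
move=> t t01 v h N v1 q qN; have /andP[t0 t1] := t01.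
have -> : h = q - M *m v by rewrite /q addrAC subrr add0r.
rewrite step_remainder.
have b1 := mx_bounded_mul (KC t t01) qN.
have b2 := mx_bounded_mul (PC t t01) v1.
have b3 := mx_bounded_mul (KC t t01) (mx_bounded_mul Ma v1).
move=> i j; have N0 : 0 <= N by apply: le_trans (qN i j).
rewrite mxE [X in _ + X]mxE; apply: le_trans (ler_normB _ _) _.
apply: le_trans (_ : (n%:R * (C1 * t ^+ 3) * N + n%:R * (C2 * t ^+ 3) * 1) +
   n%:R * (C1 * t ^+ 3) * (n%:R * a * 1) <= _).
  apply: lerD; last exact: b3.
  rewrite mxE; apply: le_trans (ler_normD _ _) _.
  by apply: lerD; [exact: b1|exact: b2].
have t3 : 0 <= t ^+ 3 by rewrite exprn_ge0.
have n0 : 0 <= n%:R :> R by [].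
rewrite -subr_ge0 (_ : _ - _ = t ^+ 3 * (n%:R * C1 + n%:R * C2 * N +
   n%:R * C1 * (n%:R * a) * N)); last by ring.
by rewrite !(mulr_ge0, addr_ge0).
Qed.

Lemma step_expansion1 (R : realType) n (Mx My : 'M[R]_n) :
  Mx + My \in unitmx ->
  exists2 C, 0 <= C & forall t, 0 <= t <= 1 -> forall (v h : 'cV[R]_n) (N : R),
    mx_bounded 1 v -> let q := (Mx + My) *m v + h in mx_bounded N q ->
    mx_bounded (C * t ^+ 2 * (1 + N))
      (Phimx Mx My t *m v + invmx (Mx + My) *m (Phimx Mx My t - 1%:M) *m h - v - t *: q).
Proof.
move=> Munit; have [C C0 CP] := step_expansion Munit.
have [m m0 Mm] := ex_rowsum_bound (Mx + My).
exists (C + m) => [|t t01 v h N v1 q qN i j]; first by rewrite addr_ge0.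
have /andP[t0 t1] := t01; have N0 : 0 <= N by apply: le_trans (qN i j).
have zE := CP t t01 v h N v1 qN.
have MqN := mx_boundedZ (t ^+ 2 / 2) (rowsum_mulmx Mm N0 qN).
move: zE MqN; rewrite -/q; set z := _ - v; set Mq := _ *m q => zE MqN.
have -> : z - t *: q = z - (t *: q + (t ^+ 2 / 2) *: Mq) + (t ^+ 2 / 2) *: Mq.
  by rewrite opprD addrA subrK.
apply: le_trans (mx_boundedD zE MqN i j) _.
have t2 : 0 <= t ^+ 2 by rewrite exprn_ge0.
rewrite ger0_norm ?divr_ge0 //.
have c1 : C * t ^+ 3 * (1 + N) <= C * t ^+ 2 * (1 + N).
  by rewrite ler_wpM2r ?addr_ge0 // ler_wpM2l // ler_wiXn2l.
have c2 : t ^+ 2 / 2 * (m * N) <= m * t ^+ 2 * (1 + N).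
  rewrite -subr_ge0 (_ : _ - _ = t ^+ 2 * m * (1 + N / 2)); last by field.
  by rewrite !mulr_ge0 // addr_ge0 // divr_ge0.
by rewrite !mulrDl; lra.
Qed.

(** If the increment z is bounded then t |q| is bounded, however large the
    reaction is.  Hence t M q may be replaced by M z, and the error becomes
    O(t^2) uniformly in h. *)
Lemma step_expansion_implicit (R : realType) n (Mx My : 'M[R]_n) :
  Mx + My \in unitmx ->
  exists C d, [/\ 0 <= C, 0 < d & forall t, 0 <= t <= d -> forall v h : 'cV[R]_n,
    mx_bounded 1 v -> let q := (Mx + My) *m v + h in
    let z := Phimx Mx My t *m v +
      invmx (Mx + My) *m (Phimx Mx My t - 1%:M) *m h - v in
    mx_bounded 1 z ->
    mx_bounded (C * t ^+ 2) (z - (t *: q + (t / 2) *: ((Mx + My) *m z)))].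
Proof.
move=> Munit; have [C1 C10 E1] := step_expansion Munit.
have [C2 C20 E2] := step_expansion1 Munit.
have [m m0 Mm] := ex_rowsum_bound (Mx + My).
have [d d0 dP] : exists2 d, 0 < d & forall t, 0 <= t <= d -> C2 * t <= 1 / 2.
  by apply: ex_small; rewrite divr_gt0.
exists (4 * C1 + 2 * m * C2), (Num.min d 1); split.
- by rewrite addr_ge0 ?mulr_ge0.
- by rewrite lt_min d0 ltr01.
move=> t /andP[t0]; rewrite le_min => /andP[td t1] v h v1 q z z1 i j.
have t01 : 0 <= t <= 1 by rewrite t0.
have C2t : C2 * t <= 1 / 2 by apply: dP; rewrite t0.
(* the norm of q has to be attained to be controlled by z *)
pose i0 := [arg max_(k > i) `|q k j|]%O.
have qN : mx_bounded `|q i0 j| q.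
  move=> k l; rewrite (ord1 l) -[0]/(0 : 'I_1) -(ord1 j).
  by rewrite /i0; case: arg_maxP => //= k' _ /(_ k isT).
set N := `|q i0 j| in qN.
have N0 : 0 <= N by exact: normr_ge0.
have zq := E2 t t01 v h N v1 qN; rewrite -/q -/z in zq.
have E1q := E1 t t01 v h N v1 qN; rewrite -/q -/z in E1q.
clearbody z; clearbody q.
have tN : t * N <= 3.
  have : t * N <= 1 + C2 * t ^+ 2 * (1 + N).
    rewrite -[t in leLHS]ger0_norm // -normrM.
    have := zq i0 j; rewrite !mxE.
    have := z1 i0 j; have := ler_normB (z i0 j) (z i0 j - t * q i0 j).
    by rewrite opprB addrCA subrr addr0; lra.
  rewrite (_ : C2 * t ^+ 2 * (1 + N) = C2 * t * (t + t * N)); last by ring.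
  have tN0 : 0 <= t + t * N by rewrite addr_ge0 // mulr_ge0.
  have : C2 * t * (t + t * N) <= 1 / 2 * (t + t * N) by rewrite ler_wpM2r.
  by lra.
have zq' : mx_bounded (4 * C2 * t) (z - t *: q).
  apply: mx_bounded_le zq.
  rewrite (_ : C2 * t ^+ 2 * (1 + N) = C2 * t * (t + t * N)); last by ring.
  apply: le_trans (_ : C2 * t * 4 <= _); last by lra.
  by rewrite ler_wpM2l ?mulr_ge0 //; lra.
have Mzq : mx_bounded (m * (4 * C2 * t)) ((Mx + My) *m (z - t *: q)).
  by apply: rowsum_mulmx => //; rewrite !mulr_ge0.
have -> : z - (t *: q + (t / 2) *: ((Mx + My) *m z)) =
    z - (t *: q + (t ^+ 2 / 2) *: ((Mx + My) *m q)) +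
    (- (t / 2)) *: ((Mx + My) *m (z - t *: q)).
  rewrite mulmxBr -scalemxAr; move: (_ *m z) (_ *m q) => Mz Mq.
  by apply/matrixP => k l; rewrite !mxE; field.
apply: le_trans (mx_boundedD E1q (mx_boundedZ _ Mzq) i j) _.
rewrite normrN ger0_norm ?divr_ge0 //.
have : C1 * t ^+ 3 * (1 + N) <= 4 * C1 * t ^+ 2.
  rewrite (_ : C1 * t ^+ 3 * (1 + N) = (C1 * t ^+ 2) * (t + t * N)); last by ring.
  apply: le_trans (_ : C1 * t ^+ 2 * 4 <= _); last by lra.
  by rewrite ler_wpM2l ?mulr_ge0 ?exprn_ge0 //; lra.
have -> : t / 2 * (m * (4 * C2 * t)) = 2 * m * C2 * t ^+ 2 by field.
by rewrite mulrDl; lra.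
Qed.

Definition nodal (R : realType) n (G : 'I_n -> R -> R) (v : 'cV[R]_n) : 'cV[R]_n :=
  \col_i G i (v i 0).

Definition step_eq (R : realType) n (Mx My : 'M[R]_n) (g : 'cV[R]_n -> 'cV[R]_n)
    (theta tau : R) (v w : 'cV[R]_n) : Prop :=
  w = Phimx Mx My tau *m v + invmx (Mx + My) *m (Phimx Mx My tau - 1%:M) *m
        (theta *: g v + (1 - theta) *: g w).

Definition nodal_reaction (R : realType) n (G : 'I_n -> R -> R) : Prop :=
  [/\ forall i s, 0 <= s < 1 -> 0 < G i s,
      forall i s t, 0 <= s -> s <= t -> t < 1 -> G i s <= G i t &
      forall i u e, 0 <= u < 1 -> 0 < e -> exists2 d, 0 < d &
        forall s, 0 <= s < 1 -> `|s - u| < d -> `|G i s - G i u| < e].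

Lemma in_unit_boxE (R : realType) n (v : 'cV[R]_n) :
  in_unit_box v -> forall i, 0 <= v i 0 < 1.
Proof. by move=> [v0 v1] i; have := v0 i; have := v1 i; rewrite !mxE => -> ->. Qed.

Lemma in_unit_box_bounded (R : realType) n (v : 'cV[R]_n) :
  in_unit_box v -> mx_bounded 1 v.
Proof.
move=> /in_unit_boxE vb i j; rewrite (ord1 j); have /andP[v0 v1] := vb i.
by rewrite ger0_norm // ltW.
Qed.

(** The states from which the semi-discretized system v' = M v + g(v) starts to
    increase in every component; this is the invariant of the scheme. *)
Definition increasing_state (R : realType) n (M : 'M[R]_n) (g : 'cV[R]_n -> 'cV[R]_n)
    (v : 'cV[R]_n) : Prop :=
  in_unit_box v /\ vlt 0 (M *m v + g v).

Lemma continuous_clamp (R : realType) (a b : R) (F : R -> R) : a <= b ->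
  (forall u e, a <= u <= b -> 0 < e -> exists2 d, 0 < d &
     forall s, a <= s <= b -> `|s - u| < d -> `|F s - F u| < e) ->
  continuous (fun s => F (Num.max a (Num.min b s))).
Proof.
move=> ab Fc s; apply/cvgrPdist_lt => e e0.
have clampP (x : R) : a <= Num.max a (Num.min b x) <= b.
  by rewrite le_max lexx ge_max ab ge_min lexx.
have [d d0 dP] := Fc _ e (clampP s) e0.
apply/nbhs_ballP; exists d => //= t; rewrite /ball /= => st.
rewrite distrC; apply: dP => //; apply: le_lt_trans st.
rewrite distrC; move: (s) (t) => x y {d d0 e e0 clampP Fc s t}.
rewrite ler_norml; have := ler_norm (x - y); have := ler_norm (y - x).
rewrite (distrC y x) /Num.max /Num.min; move: `|x - y| => r.
case: (ltP b x) => bx; case: (ltP b y) => yb; case: (ltP a b) => ?;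
  case: (ltP a x) => ?; case: (ltP a y) => ?; lra.
Qed.

(** Clamping the argument of the reaction to [v, v + eta] makes it continuous and
    bounded, so that [separable_fixpoint] applies.  The fixed point w satisfies
    t (M v + g(v)) - O(t^2) <= w - v <= O(t), hence lies in [v, v + eta] for
    small t, where the clamping has no effect. *)
Lemma exists_step (R : realType) n (Mx My : 'M[R]_n) (G : 'I_n -> R -> R)
    (theta : R) (v : 'cV[R]_n) :
  Mx + My \in unitmx -> nodal_reaction G -> 0 <= theta <= 1 ->
  increasing_state (Mx + My) (nodal G) v ->
  exists2 d, 0 < d & forall t, 0 <= t <= d ->
    exists w, in_unit_box w /\ step_eq Mx My (nodal G) theta t v w.
Proof.
move=> Munit [G0 Gm Gc] /andP[th0 th1] [vbox vinc].
have v1 := in_unit_box_bounded vbox; have vb := in_unit_boxE vbox.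
have [C C0 E1] := step_expansion1 Munit.
pose p i := ((Mx + My) *m v + nodal G v) i 0.
have p0 i : 0 < p i by have := vinc i; rewrite mxE.
have [e e0 pe] := ex_pos_lower_bound p0.
have [eta eta0 veta] : exists2 eta, 0 < eta & forall i, v i 0 + eta < 1.
  have [|eta eta0 etaP] := @ex_pos_lower_bound R n (fun i => (1 - v i 0) / 2).
    by move=> i; have := vb i; lra.
  by exists eta => // i; have := etaP i; have := vb i; lra.
pose cl i (s : R) := Num.max (v i 0) (Num.min (v i 0 + eta) s).
have clP i s : v i 0 <= cl i s <= v i 0 + eta.
  by rewrite /cl le_max lexx ge_max ge_min lexx lerDl (ltW eta0).
have cl01 i s : 0 <= cl i s < 1.
  have /andP[c1 c2] := clP i s; have /andP[v0 _] := vb i.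
  by rewrite (le_trans v0 c1) (le_lt_trans c2 (veta i)).
pose phi i s := G i (cl i s).
have phi_cont i : continuous (phi i).
  apply: (@continuous_clamp R (v i 0) (v i 0 + eta) (G i)) => [|u e' ub e'0].
    by rewrite lerDl ltW.
  have [|d d0 dP] := Gc i u e' _ e'0; first by have := vb i; have := veta i; lra.
  by exists d => // s sb; apply: dP; have := vb i; have := veta i; lra.
have phi_ge i s : G i (v i 0) <= phi i s.
  by apply: Gm; have := vb i; have := clP i s; have := cl01 i s; lra.
have phi_le i s : phi i s <= G i (v i 0 + eta).
  by apply: Gm; have := vb i; have := clP i s; have := cl01 i s; have := veta i; lra.
pose B := \sum_i G i (v i 0 + eta).
have G_eta i : 0 <= G i (v i 0 + eta).
  by apply/ltW/G0; have := vb i; have := veta i; lra.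
have GB i : G i (v i 0 + eta) <= B.
  by rewrite /B (bigD1 i) //= lerDl sumr_ge0.
have phi_pos i s : 0 < phi i s by exact: G0.
have phiB i s : `|phi i s| <= B.
  by rewrite ger0_norm ?(ltW (phi_pos i s)) // (le_trans (phi_le i s)).
have [m m0 Mm] := ex_rowsum_bound (Mx + My).
pose N := m + 2 * B.
have B0 : 0 <= B by rewrite sumr_ge0.
have N0 : 0 <= N by rewrite /N; lra.
have [d1 d10 d1P] := ex_small (C * (1 + N)) e0.
have [d2 d20 d2P] := ex_small (N + C * (1 + N)) eta0.
exists (Num.min (Num.min d1 d2) 1); first by rewrite !lt_min d10 d20 ltr01.
move=> t /andP[t0]; rewrite !le_min => /andP[/andP[td1 td2] t1].
have {d1P}c1 : C * (1 + N) * t <= e by apply: d1P; rewrite t0.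
have {d2P}c2 : (N + C * (1 + N)) * t <= eta by apply: d2P; rewrite t0.
have t01 : 0 <= t <= 1 by rewrite t0.
set Phi := Phimx Mx My t; set K := invmx (Mx + My) *m (Phi - 1%:M).
have [s sE] := @separable_fixpoint R n ((1 - theta) *: K)
  (fun i => (Phi *m v + theta *: (K *m nodal G v)) i 0) phi B phi_cont phiB.
pose w : 'cV[R]_n := \col_i s i.
pose k : 'cV[R]_n := \col_i phi i (s i).
pose h := theta *: nodal G v + (1 - theta) *: k.
have wE : w = Phi *m v + K *m h.
  apply/matrixP => i j; rewrite (ord1 j) mxE sE /affsum.
  rewrite /h mulmxDr -!scalemxAr addrA [RHS]mxE; congr (_ + _).
  rewrite [RHS]mxE [X in _ * X]mxE mulr_sumr; apply: eq_bigr => l _.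
  by rewrite !mxE mulrA.
have hi i : h i 0 = theta * G i (v i 0) + (1 - theta) * phi i (s i).
  by rewrite !mxE.
have qN : mx_bounded N ((Mx + My) *m v + h).
  move=> i j; rewrite (ord1 j) mxE hi; apply: le_trans (ler_normD _ _) _.
  have := rowsum_mulmx Mm ler01 v1 i 0; rewrite mulr1 => Mv.
  have Gv : 0 <= G i (v i 0) <= B.
    by rewrite ltW ?G0 //= (le_trans (phi_ge i (s i))) // (le_trans _ (phiB i (s i))) // ler_norm.
  have phs : 0 <= phi i (s i) <= B.
    by rewrite ltW //= (le_trans _ (phiB i (s i))) // ler_norm.
  rewrite [X in _ + X]ger0_norm; last first.
    by move: th0 th1 Gv phs; clear; nra.
  by rewrite /N; move: Mv th0 th1 Gv phs B0; clear; nra.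
have qp i : p i <= ((Mx + My) *m v + h) i 0.
  rewrite /p mxE [leRHS]mxE lerD2l hi mxE.
  by move: th0 th1 (phi_ge i (s i)); clear; nra.
have zP i : v i 0 <= w i 0 <= v i 0 + eta.
  have := E1 t t01 v h N v1 qN i 0; rewrite -/Phi -/K -wE.
  have := qN i 0; have := qp i; have := pe i.
  move: ((Mx + My) *m v + h) => q; rewrite !mxE -[s i]/(s i) => pei qpi qNi zi.
  have tq : t * e <= t * q i 0 by rewrite ler_wpM2l //; lra.
  have tN : t * q i 0 <= t * N by rewrite ler_wpM2l // (le_trans (ler_norm _)).
  have cc1 : C * t ^+ 2 * (1 + N) <= t * e.
    by rewrite (_ : _ * _ = t * (C * (1 + N) * t)) ?ler_wpM2l //; ring.
  have cc2 : C * t ^+ 2 * (1 + N) <= C * (1 + N) * t.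
    rewrite (_ : C * t ^+ 2 * (1 + N) = (C * (1 + N) * t) * t); last by ring.
    by rewrite ler_piMr // !mulr_ge0 // addr_ge0.
  move: zi; rewrite ler_norml => /andP[].
  by move: tq tN cc1 cc2 c2; clear; lra.
have kE : k = nodal G w.
  apply/matrixP => i j; rewrite !mxE /phi; congr (G i _); rewrite /cl.
  have := zP i; rewrite mxE => /andP[ws1 ws2].
  by rewrite min_r // max_r.
exists w; split; last by rewrite /step_eq -kE -/Phi -/K -/h.
split => i; rewrite !mxE; move: (zP i) (vb i) (veta i); rewrite mxE; clear; lra.
Qed.

Lemma offdiag_row_ge (R : realDomainType) n (M : 'M[R]_n) (m c : R) (z : 'cV[R]_n) i :
  offdiag_ge0 M -> (forall k, \sum_j `|M k j| <= m) -> 0 <= c ->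
  (forall j, - c <= z j 0) -> - (m * Num.max c `|z i 0|) <= (M *m z) i 0.
Proof.
move=> offM Mm c0 zc; set r := Num.max c _.
have r0 : 0 <= r by rewrite le_max c0.
apply: le_trans (_ : - ((\sum_j `|M i j|) * r) <= _).
  by rewrite lerN2 ler_wpM2r.
rewrite mxE -mulNr -sumrN mulr_suml ler_sum // => j _.
have [<-|ij] := eqVneq i j.
  rewrite mulNr lerNl; apply: le_trans (ler_norm _) _.
  by rewrite normrN normrM ler_wpM2l // le_max lexx orbT.
rewrite ger0_norm; last exact: offM.
rewrite mulNr -mulrN ler_wpM2l ?offM //.
by apply: le_trans (zc j); rewrite lerN2 le_max lexx.
Qed.

(** The equation may have solutions w far from v, with components close to 1
    where the reaction is of order 1/t; the argument covers them all.  Let e > 0 be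
    a lower bound of M v + g(v) and m a bound for the row sums of |M|.  By
    [step_expansion_implicit], z = w - v satisfies z = t q + (t/2) M z + O(t^2).
    First, q >= M v >= - O(1) gives z >= - L t, so that g(w) >= g(v) - e/4 by
    continuity at v and monotonicity.  If z_i < t e/4, then (M z)_i >= - O(t)
    because only z_i itself enters with a negative sign, and the equation gives
    the contradiction z_i >= t (e - e/4) - t e/4.  So z_i >= t e/4 for all i.
    Finally (M w + g(w))_i > 0: if z_i <= eta, then (M w + g(w))_i is at least
    (M v + g(v))_i - m eta; otherwise z_i = O(t) (1 + g_i(w_i)) forces g_i(w_i)
    to exceed the bound m for the entries of M w. *)
Lemma step_increasing (R : realType) n (Mx My : 'M[R]_n) (G : 'I_n -> R -> R)
    (theta : R) (v : 'cV[R]_n) :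
  Mx + My \in unitmx -> offdiag_ge0 (Mx + My) -> nodal_reaction G ->
  0 <= theta <= 1 -> increasing_state (Mx + My) (nodal G) v ->
  exists2 d, 0 < d & forall t, 0 <= t <= d -> forall w,
    in_unit_box w -> step_eq Mx My (nodal G) theta t v w ->
    [/\ vle v w, 0 < t -> vlt v w & increasing_state (Mx + My) (nodal G) w].
Proof.
move=> Munit offM [G0 Gm Gc] /andP[th0 th1] [vbox vinc].
have v1 := in_unit_box_bounded vbox; have vb := in_unit_boxE vbox.
have [C [d0 [C0 d00 E1]]] := step_expansion_implicit Munit.
have [m m0 Mm] := ex_rowsum_bound (Mx + My).
set M := Mx + My in Munit offM vinc E1 Mm *.
pose p i := (M *m v + nodal G v) i 0.
have p0 i : 0 < p i by have := vinc i; rewrite mxE.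
have [e e0 pe] := ex_pos_lower_bound p0.
pose L := 2 * m + C + e.
have L0 : 0 <= L by rewrite /L; lra.
(* how far below v the reaction may be evaluated *)
have [r r0 rP] : exists2 r, 0 < r & forall i s, 0 <= s < 1 -> `|s - v i 0| < r ->
    `|G i s - G i (v i 0)| < e / 4.
  have e4 : 0 < e / 4 by lra.
  have ri i : exists d, 0 < d /\ forall s, 0 <= s < 1 -> `|s - v i 0| < d ->
      `|G i s - G i (v i 0)| < e / 4.
    by have [d d0' dP] := Gc i (v i 0) (e / 4) (vb i) e4; exists d.
  pose rr i := projT1 (cid (ri i)).
  have rrP i := projT2 (cid (ri i)).
  have [r r0 rle] := @ex_pos_lower_bound R n rr (fun i => (rrP i).1).
  exists r => // i s s01 sr; apply: (rrP i).2 => //.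
  exact: lt_le_trans sr (rle i).
have r2 : 0 < r / 2 by lra.
have e4 : 0 < e / 4 by lra.
pose eta := e / (2 * (m + 1)).
have eta0 : 0 < eta by rewrite divr_gt0 // mulr_gt0 //; lra.
have eta_m : m * eta <= e / 2.
  have : (m + 1) * eta = e / 2 by rewrite /eta; field; rewrite gt_eqF //; lra.
  by rewrite mulrDl; lra.
have eta4 : 0 < eta / 4 by lra.
have [d1 d10 d1P] := ex_small L r2.
have [d2 d20 d2P] := ex_small (L * m / 2 + C) e4.
have [d3 d30 d3P] := ex_small (m + C + 2 * m) eta4.
exists (Num.min (Num.min d0 (Num.min d1 (Num.min d2 d3))) 1).
  by rewrite !lt_min d00 d10 d20 d30 ltr01.
move=> t /andP[t0]; rewrite !le_min => /andP[/and4P[td0 td1 td2 td3] t1] w wbox weq.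
have {d1P}c1 : L * t <= r / 2 by apply: d1P; rewrite t0.
have {d2P}c2 : (L * m / 2 + C) * t <= e / 4 by apply: d2P; rewrite t0.
have {d3P}c3 : (m + C + 2 * m) * t <= eta / 4 by apply: d3P; rewrite t0.
have w1 := in_unit_box_bounded wbox; have wb := in_unit_boxE wbox.
have td : 0 <= t <= d0 by rewrite t0.
pose h := theta *: nodal G v + (1 - theta) *: nodal G w.
have := E1 t td v h v1; rewrite /= -weq; set z := w - v; set q := M *m v + h.
have zE i : z i 0 = w i 0 - v i 0 by rewrite !mxE.
have z1 : mx_bounded 1 z.
  move=> i j; rewrite (ord1 j) zE ler_norml.
  by move: (wb i) (vb i); clear; lra.
move=> /(_ z1) E1z.
have Mz_le i : `|(M *m z) i 0| <= m.
  by have := rowsum_mulmx Mm ler01 z1 i 0; rewrite mulr1.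
have Mv_le i : `|(M *m v) i 0| <= m.
  by have := rowsum_mulmx Mm ler01 v1 i 0; rewrite mulr1.
have Mw_le i : `|(M *m w) i 0| <= m.
  by have := rowsum_mulmx Mm ler01 w1 i 0; rewrite mulr1.
have qE i : q i 0 = (M *m v) i 0 + (theta * G i (v i 0) + (1 - theta) * G i (w i 0)).
  by rewrite mxE; congr (_ + _); rewrite !mxE.
have {}E1z i : `|z i 0 - (t * q i 0 + t / 2 * (M *m z) i 0)| <= C * t ^+ 2.
  have entry (a b c : 'cV[R]_n) x y :
      (a - (x *: b + y *: c)) i 0 = a i 0 - (x * b i 0 + y * c i 0).
    by rewrite !mxE.
  by rewrite -entry.
have pE i : p i = (M *m v) i 0 + G i (v i 0) by rewrite /p mxE; congr (_ + _); rewrite mxE.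
have Ct2 : 0 <= C * t ^+ 2 <= C * t.
  by rewrite mulr_ge0 ?exprn_ge0 //= ler_wpM2l // expr2 ler_piMr.
have Gv0 i : 0 < G i (v i 0) by exact: G0.
have Gw0 i : 0 < G i (w i 0) by exact: G0.
have z_ge i : - (L * t) <= z i 0.
  have := E1z i; rewrite ler_norml => /andP[zl _].
  have : - (t * m) <= t * q i 0.
    rewrite -mulrN ler_wpM2l // qE.
    have := Mv_le i; rewrite ler_norml => /andP[+ _].
    by move: th0 th1 (Gv0 i) (Gw0 i); clear; nra.
  have : - (t * m) <= t / 2 * (M *m z) i 0.
    have := Mz_le i; rewrite ler_norml => /andP[+ _].
    by move: t0 m0; clear; nra.
  have : 0 <= e * t by rewrite mulr_ge0 // ltW.
  by move: Ct2 zl; rewrite /L; clear; lra.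
have Lt0 : 0 <= L * t by rewrite mulr_ge0.
have Gw_ge i : G i (v i 0) - e / 4 <= G i (w i 0).
  have [vw|wv] := leP (v i 0) (w i 0).
    by move: (Gm i (v i 0) (w i 0)) (vb i) (wb i) vw e0; clear; lra.
  have : `|w i 0 - v i 0| < r.
    by rewrite ltr0_norm ?subr_lt0 //; move: (z_ge i) c1 r0; rewrite zE; clear; lra.
  by move=> /(rP i _ (wb i)); rewrite ltr_norml => /andP[]; clear; lra.
have z_pos i : t * (e / 4) <= z i 0.
  rewrite leNgt; apply/negP => zi.
  have te : t * e >= 0 by rewrite mulr_ge0 // ltW.
  have Lte : t * e <= L * t.
    by rewrite /L mulrDl [e * t]mulrC lerDr; move: m0 C0 t0; clear; nra.
  have zabs : `|z i 0| <= L * t.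
    by rewrite ler_norml (z_ge i) /=; move: zi Lte te; clear; lra.
  have := offdiag_row_ge i offM Mm Lt0 z_ge; rewrite max_l // => Mz_ge.
  have := E1z i; rewrite ler_norml => /andP[zl _].
  have tq : t * (3 * e / 4) <= t * q i 0.
    rewrite ler_wpM2l // qE; have := pe i; rewrite pE.
    by move: th0 th1 e0 (Gw_ge i); clear; nra.
  have tMz : t / 2 * - (m * (L * t)) <= t / 2 * (M *m z) i 0.
    by rewrite ler_wpM2l // divr_ge0.
  have tc2 : t * ((L * m / 2 + C) * t) <= t * (e / 4) by rewrite ler_wpM2l.
  by move: zl zi tq tMz tc2 te (Mz_ge) Ct2; clear; lra.
have z0 i : 0 <= z i 0 by apply: le_trans (z_pos i); rewrite mulr_ge0 // ltW.
have G_le i : G i (v i 0) <= G i (w i 0).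
  by move: (Gm i (v i 0) (w i 0)) (vb i) (wb i) (z0 i); rewrite zE; clear; lra.
split.
- by move=> i; have := z0 i; rewrite zE subr_ge0.
- move=> tpos i; rewrite -subr_gt0 -zE; apply: lt_le_trans (z_pos i).
  by rewrite mulr_gt0.
split=> // i; rewrite mxE [ltRHS]mxE [X in _ + X]mxE.
have z00 j : - 0 <= z j 0 by rewrite oppr0.
have := offdiag_row_ge i offM Mm (lexx 0) z00.
rewrite ger0_norm ?z0 // max_r ?z0 // => Mz_ge.
have [z_small|z_big] := leP (z i 0) eta.
  have -> : (M *m w) i 0 = (M *m v) i 0 + (M *m z) i 0.
    have {1}-> : w = v + z by rewrite /z addrC subrK.
    by rewrite mulmxDr mxE.
  have := pe i; rewrite pE.
  have : m * z i 0 <= m * eta by rewrite ler_wpM2l.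
  by move: Mz_ge (G_le i) eta_m e0; clear; lra.
have Gw_big : m < G i (w i 0).
  rewrite ltNge; apply/negP => Gwm.
  have := E1z i; rewrite ler_norml => /andP[_ zu].
  have tq : t * q i 0 <= t * (2 * m).
    rewrite ler_wpM2l // qE.
    have := Mv_le i; rewrite ler_norml => /andP[_].
    by move: th0 th1 (Gv0 i) (G_le i) Gwm; clear; nra.
  have tMz : t / 2 * (M *m z) i 0 <= t * m.
    have := Mz_le i; rewrite ler_norml => /andP[_].
    by move: t0 m0; clear; nra.
  by move: zu tq tMz c3 z_big Ct2 m0 t0 eta0; clear; lra.
by have := Mw_le i; rewrite ler_norml => /andP[]; move: Gw_big; clear; lra.
Qed.

(** * The scheme *)

Lemma reaction_nodal (R : realType) (E : set R) (f : R -> R -> R) n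
    (e s : 'I_n -> R) :
  reaction E f -> (forall k, E (e k)) -> (forall k, 0 < s k) ->
  nodal_reaction (fun k u => f (e k) u / s k).
Proof.
move=> [_ df _ _ fbounds] Ee s0; split.
- move=> k u u01; have [fmin [fmax [fmin0 fle]]] := fbounds u u01.
  have /andP[fu _] := fle _ (Ee k).
  by rewrite divr_gt0 // (lt_le_trans fmin0).
- move=> k u u' u0 uu' u'1; rewrite ler_pM2r ?invr_gt0 //.
  by apply: is_derive01_nondecreasing => // x x01; exact: df.
- move=> k u x u01 x0; have [l [fl _]] := df _ _ (Ee k) u01.
  have [d d0 dP] := is_derive01_continuous fl (mulr_gt0 x0 (s0 k)).
  exists d => // t t01 tu; rewrite -mulrBl normrM normfV (gtr0_norm (s0 k)).
  by rewrite ltr_pdivrMr // dP.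
Qed.

Lemma ex_step_bound (R : realType) n (Mx My : 'M[R]_n) (G : 'I_n -> R -> R)
    (theta : R) (v : 'cV[R]_n) :
  Mx + My \in unitmx -> offdiag_ge0 (Mx + My) -> nodal_reaction G ->
  0 <= theta <= 1 ->
  exists d, 0 < d /\ (increasing_state (Mx + My) (nodal G) v ->
    forall t, 0 <= t <= d ->
    (exists w, in_unit_box w /\ step_eq Mx My (nodal G) theta t v w) /\
    forall w, in_unit_box w -> step_eq Mx My (nodal G) theta t v w ->
    [/\ vle v w, 0 < t -> vlt v w & increasing_state (Mx + My) (nodal G) w]).
Proof.
move=> Munit offM Gr th01.
have [vg|nvg] := pselect (increasing_state (Mx + My) (nodal G) v); last first.
  by exists 1.
have [d1 d10 d1P] := exists_step Munit Gr th01 vg.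
have [d2 d20 d2P] := step_increasing Munit offM Gr th01 vg.
exists (Num.min d1 d2); split=> [|_ t /andP[t0]]; first by rewrite lt_min d10.
rewrite le_min => /andP[td1 td2].
by split; [apply: d1P|apply: d2P]; rewrite t0.
Qed.

(** The states that follow an increasing state are increasing, so that
    [exists_step] and [step_increasing] apply all along the sequence.  For
    theta = 1 the equation determines its solution, which is therefore the one
    in the unit box found by [exists_step]. *)
Lemma monotone_scheme (R : realType) n (Mx My : 'M[R]_n) (G : 'I_n -> R -> R)
    (theta : R) (v0 : 'cV[R]_n) :
  Mx + My \in unitmx -> offdiag_ge0 (Mx + My) -> nodal_reaction G ->
  0 <= theta <= 1 -> increasing_state (Mx + My) (nodal G) v0 ->
  exists delta : 'cV[R]_n -> R,
  [/\ forall v, 0 < delta v,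
      forall step : nat -> 'cV[R]_n -> R,
        (forall k v, 0 <= step k v <= delta v) ->
        exists v : nat -> 'cV[R]_n, v 0%N = v0 /\
          scheme_solution Mx My (nodal G) theta (fun k => step k (v k)) v
    & forall (tau : nat -> R) (v : nat -> 'cV[R]_n),
        v 0%N = v0 ->
        (forall k, 0 <= tau k <= delta (v k)) ->
        scheme_solution Mx My (nodal G) theta tau v ->
        forall k, [/\ vle (v k) (v k.+1),
                      0 < tau k -> vlt (v k) (v k.+1)
                    & in_unit_box (v k)]].
Proof.
move=> Munit offM Gr th01 v0g.
pose good := increasing_state (Mx + My) (nodal G).
pose delta v := projT1 (cid (ex_step_bound v Munit offM Gr th01)).
have deltaP v := projT2 (cid (ex_step_bound v Munit offM Gr th01)).
exists delta; split=> [v|step stepP|tau v v00 tauP sol].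
- exact: (deltaP v).1.
- have next k v : exists w, good v -> [/\ in_unit_box w, good w &
      step_eq Mx My (nodal G) theta (step k v) v w].
    have [vg|nvg] := pselect (good v); last by exists v.
    have [[w [wbox weq]] inc] := (deltaP v).2 vg _ (stepP k v).
    by exists w => _; split=> //; have [] := inc w wbox weq.
  pose vs := nat_rect (fun _ => 'cV[R]_n) v0 (fun k v => projT1 (cid (next k v))).
  have vsP k : good (vs k) -> [/\ in_unit_box (vs k.+1), good (vs k.+1) &
      step_eq Mx My (nodal G) theta (step k (vs k)) (vs k) (vs k.+1)].
    exact: projT2 (cid (next k (vs k))).
  have vs_good k : good (vs k) by elim: k => // k /vsP[].
  by exists vs; split=> // M k; have [? _ ?] := vsP k (vs_good k).
have sol_step k : good (v k) -> in_unit_box (v k.+1) /\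
    step_eq Mx My (nodal G) theta (tau k) (v k) (v k.+1).
  move=> vg; have [veq vbox] := sol k; split=> //.
  have /andP[_] := th01; rewrite le_eqVlt => /orP[/eqP th1|]; last exact: vbox.
  have [[w [wbox weq]] _] := (deltaP (v k)).2 vg _ (tauP k).
  suff -> : v k.+1 = w by [].
  by rewrite veq weq th1 subrr !scale0r.
have v_good k : good (v k).
  elim: k => [|k vg]; first by rewrite v00.
  have [vbox veq] := sol_step k vg.
  by have [] := ((deltaP (v k)).2 vg _ (tauP k)).2 _ vbox veq.
move=> k; have [vbox veq] := sol_step k (v_good k).
have [le_v lt_v _] := ((deltaP (v k)).2 (v_good k) _ (tauP k)).2 _ vbox veq.
by split=> //; have [] := v_good k.
Qed.

Theorem lemma4p3 (R : realType)
  (d : measure_display) (Omega : measurableType d) (P : probability Omega R)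
  (a b theta : R) (Nx Ny : nat) (x y : nat -> R) (sigma : R -> R -> R)
  (E : set R) (eps : R -> R -> {RV P >-> R}) (f : R -> R -> R) :
  0 < a -> 0 < b -> 0 <= theta <= 1 ->
  (0 < Nx)%N -> (0 < Ny)%N -> mesh Nx x -> mesh Ny y ->
  degeneracy sigma ->
  bounded_set E ->
  (forall p q omega, -1 <= p <= 1 -> -1 <= q <= 1 -> E (eps p q omega)) ->
  reaction E f ->
  forall (omega : Omega) (v0 : 'cV[R]_(Ny * Nx)),
  let Mx := Mxmx Nx Ny x y sigma a in
  let My := Mymx Nx Ny x y sigma b in
  let g := @gvec R Nx Ny x y sigma f (fun p q => eps p q omega) in
  in_unit_box v0 ->
  vlt 0 ((Mx + My) *m v0 + g v0) ->
  exists delta : 'cV[R]_(Ny * Nx) -> R,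
  [/\ forall v, 0 < delta v,
      forall step : nat -> 'cV[R]_(Ny * Nx) -> R,
        (forall k v, 0 <= step k v <= delta v) ->
        exists v : nat -> 'cV[R]_(Ny * Nx), v 0%N = v0 /\
          scheme_solution Mx My g theta (fun k => step k (v k)) v
    & forall (tau : nat -> R) (v : nat -> 'cV[R]_(Ny * Nx)),
        v 0%N = v0 ->
        (forall k, 0 <= tau k <= delta (v k)) ->
        scheme_solution Mx My g theta tau v ->
        forall k, [/\ vle (v k) (v k.+1),
                      0 < tau k -> vlt (v k) (v k.+1)
                    & in_unit_box (v k)]].
Proof.
move=> a0 b0 th01 _ _ mx my deg _ epsE reac omega v0 Mx My g v0box v0inc.
have Munit : Mx + My \in unitmx by exact: M_unitmx.
have offM : offdiag_ge0 (Mx + My) by exact: M_offdiag_ge0.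
pose node (k : 'I_(Ny * Nx)) := (grid_x x k, grid_y y k).
have Gr : nodal_reaction (fun k u =>
    f (eps (node k).1 (node k).2 omega) u / sigma (node k).1 (node k).2).
  apply: (reaction_nodal reac) => k /=; last exact: sigma_interior_gt0.
  have /andP[xl xr] := mesh_interior (mxtens_unindex k).2 mx.
  have /andP[yl yr] := mesh_interior (mxtens_unindex k).1 my.
  by apply: epsE; rewrite !ltW.
exact: (monotone_scheme Munit offM Gr th01 (conj v0box v0inc)).
Qed.
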